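(* Let $Q$ and $Q'$ be queries over $L$ and let $J$ be a non-trivial model of $\mathrm{FEA}(L)$. Then (1) $Q\approx_J Q'$ iff $Q\approx Q'$; (2) $Q\preceq_J Q'$ iff $Q\preceq Q'$. In particular, if $Q$ and $Q'$ are equivalent queries in solved form, then they are isomorphic.
   Context: Fix a first-order language $L$ with equality, whose set of function symbols contains at least one constant; $\mathit{True}$, $\mathit{False}$ are formulas. $\mathrm{FEA}(L)$ is the theory of free equality axioms: $f(x_1,\dots,x_n)=f(y_1,\dots,y_n)\leftrightarrow x_1=y_1\wedge\dots\wedge x_n=y_n$ for each $n$-ary $f$; $f(\bar x)=g(\bar y)\leftrightarrow\mathit{False}$ for distinct function symbols $f,g$; $x=t\leftrightarrow\mathit{False}$ whenever $x\not\equiv t$ and $x$ occurs in $t$. A pre-interpretation $J$: nonempty domain $U_J$ plus interpretation of function symbols, $=$ is identity; $V_J$ is the set of $J$-valuations (maps from variables to $U_J$, extended to terms). $J$ is a non-trivial model of $\mathrm{FEA}(L)$ if all axioms of $\mathrm{FEA}(L)$ are true in $J$ and $U_J$ has at least two elements. The $J$-base $B_J$ is the set of $p(d_1,\dots,d_n)$, $p$ a non-equality predicate symbol, $d_i\in U_J$; an interpretation based on $J$ is a subset of $B_J$; a multiinterpretation based on $J$ is a finite sequence of such. A query is a formula built from $\mathit{True}$, $\mathit{False}$, equations and atoms using only $\wedge$ and $\exists$; $|Q|$ is its number of atom occurrences. Solution sets for $\bar I$ of length $|Q|$: $\mathrm{Sol}_J(\mathit{True},\varepsilon)=V_J$, $\mathrm{Sol}_J(\mathit{False},\varepsilon)=\emptyset$,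 $\mathrm{Sol}_J(s=t,\varepsilon)=\{h:h(s)=h(t)\}$, $\mathrm{Sol}_J(A,(I))=\{h:h(A)\in I\}$ for an atom $A$, $\mathrm{Sol}_J(Q_1\wedge Q_2,\bar I_1\bar I_2)=\mathrm{Sol}_J(Q_1,\bar I_1)\cap\mathrm{Sol}_J(Q_2,\bar I_2)$ ($|\bar I_i|=|Q_i|$), $\mathrm{Sol}_J((\exists x)Q,\bar I)=\{h: h[x\mapsto d]\in\mathrm{Sol}_J(Q,\bar I)$ for some $d\}$. $Q\preceq_J Q'$ iff $|Q|=|Q'|$ and $\mathrm{Sol}_J(Q,\bar I)\subseteq\mathrm{Sol}_J(Q',\bar I)$ for all multiinterpretations $\bar I$ based on $J$ of length $|Q|$; $Q\approx_J Q'$ likewise with equality. $Q\preceq Q'$ iff $Q\preceq_K Q'$ for every pre-interpretation $K$ that is a model of $\mathrm{FEA}(L)$; $Q\approx Q'$ iff $Q\preceq Q'$ and $Q'\preceq Q$ (''equivalent''). Solved form: $\mathit{True}$, $\mathit{False}$, or $(\exists z_1)\dots(\exists z_k)(x_1=s_1\wedge\dots\wedge x_n=s_n\wedge A_1\wedge\dots\wedge A_m)$ with the $x_i,z_j$ pairwise distinct variables, no $x_i$ occurring in any $s_j$ or atom $A_l$, each $z_j$ occurring in the conjunction, and $z_j\not\equiv s_i$ for all $i,j$. For such $Q$, a query $Q'$ is obtained by an elementary transformation if (a) it results from permuting the equations and permuting the quantifier prefix; or (b) $Q'$ is a variant of $Q$ (obtained by replacing parts $(\exists x)G$ by $(\exists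 y)G_x[y]$ with $y$ not free in $G$); or (c) $Q'\equiv Q_{u_1,\dots,u_k,v_1,\dots,v_k}[v_1,\dots,v_k,u_1,\dots,u_k]$ (simultaneous replacement of free occurrences) where $u_1=v_1,\dots,u_k=v_k$ are equations of $Q$ with $v_1,\dots,v_k$ distinct variables. $Q'$ is isomorphic to $Q$ if it is obtained from $Q$ by a finite sequence of elementary transformations. *)

(* Defs.v *)
From mathcomp Require Import all_boot.
From mathcomp Require Import boolp classical_sets.
From Stdlib Require Import Relations Permutation.

Set Implicit Arguments.
Unset Strict Implicit.
Unset Printing Implicit Defensive.

Local Open Scope classical_set_scope.

(* Equality is a logical symbol: [psym] holds the non-equality predicates. *)
Record language := Language {
  fsym : Type;
  farity : fsym -> nat;
  psym : Type;
  parity : psym -> nat }.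

Definition var := nat.

Inductive term (L : language) : Type :=
| Var of var
| App (f : fsym L) of {ffun 'I_(farity f) -> term L}.

Arguments Var {L} x.
Arguments App {L} f a.

(* p(a_1, ..., a_n) with the a_i in T: an atom when T is the type of terms,
   an element of the J-base when T is the domain of J. *)
Record papp (L : language) (T : Type) := PApp {
  head : psym L;
  args : {ffun 'I_(parity head) -> T} }.

Definition atom (L : language) := papp L (term L).

Definition papp_map (L : language) (T T' : Type) (g : T -> T') (A : papp L T) :
  papp L T' := PApp [ffun i => g (args A i)].

Inductive query (L : language) : Type :=
| QTrue
| QFalse
| QEq of term L & term L
| QAtom of atom L
| QAnd of query L & query L
| QEx of var & query L.

Arguments QTrue {L}.
Arguments QFalse {L}.
Arguments QEx {L} x Q.

Fixpoint natoms (L : language) (Q : query L) : nat :=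
  match Q with
  | QTrue | QFalse | QEq _ _ => 0
  | QAtom _ => 1
  | QAnd Q1 Q2 => natoms Q1 + natoms Q2
  | QEx _ Q1 => natoms Q1
  end.

Fixpoint occurs (L : language) (x : var) (t : term L) : Prop :=
  match t with
  | Var y => x = y
  | App f a => exists i, occurs x (a i)
  end.

Definition occurs_atom (L : language) (x : var) (A : atom L) : Prop :=
  exists i, occurs x (args A i).

Fixpoint free (L : language) (x : var) (Q : query L) : Prop :=
  match Q with
  | QTrue | QFalse => False
  | QEq s t => occurs x s \/ occurs x t
  | QAtom A => occurs_atom x A
  | QAnd Q1 Q2 => free x Q1 \/ free x Q2
  | QEx y Q1 => x <> y /\ free x Q1
  end.

Definition upd (T : Type) (h : var -> T) (x : var) (d : T) : var -> T :=
  fun y => if y == x then d else h y.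

Fixpoint rename_term (L : language) (r : var -> var) (t : term L) : term L :=
  match t with
  | Var x => Var (r x)
  | App f a => App f [ffun i => rename_term r (a i)]
  end.

(* Simultaneous replacement of the free occurrences of every x by r x; it does
   not rename bound variables, so capture has to be excluded separately. *)
Fixpoint rename (L : language) (r : var -> var) (Q : query L) : query L :=
  match Q with
  | QTrue => QTrue
  | QFalse => QFalse
  | QEq s t => QEq (rename_term r s) (rename_term r t)
  | QAtom A => QAtom (papp_map (rename_term r) A)
  | QAnd Q1 Q2 => QAnd (rename r Q1) (rename r Q2)
  | QEx x Q1 => QEx x (rename (upd r x x) Q1)
  end.

(* y is substitutable for x in Q: no free occurrence of x lies in the scope of
   a quantifier (exists y). *)
Fixpoint substitutable (L : language) (x y : var) (Q : query L) : Prop :=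
  match Q with
  | QTrue | QFalse | QEq _ _ | QAtom _ => True
  | QAnd Q1 Q2 => substitutable x y Q1 /\ substitutable x y Q2
  | QEx z Q1 => free x (QEx z Q1) -> z <> y /\ substitutable x y Q1
  end.

Record preinterp (L : language) := PreInterp {
  dom :> Type;
  dom_inhabited : inhabited dom;
  fint : forall f : fsym L, {ffun 'I_(farity f) -> dom} -> dom }.

Section Semantics.
Variables (L : language) (J : preinterp L).

Definition valuation := var -> J.

Fixpoint eval (h : valuation) (t : term L) : J :=
  match t with
  | Var x => h x
  | App f a => fint [ffun i => eval h (a i)]
  end.

(* The universal closures of the axioms of FEA(L) hold in J. *)
Record FEA_model : Prop := {
  FEA_inj : forall (f : fsym L) (a b : {ffun 'I_(farity f) -> J}),
    fint a = fint b <-> forall i, a i = b i;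
  FEA_disj : forall (f g : fsym L) (a : {ffun 'I_(farity f) -> J})
    (b : {ffun 'I_(farity g) -> J}), f <> g -> (fint a = fint b <-> False);
  FEA_occ : forall (x : var) (t : term L), t <> Var x -> occurs x t ->
    forall h : valuation, h x = eval h t <-> False }.

Definition nontrivial : Prop := exists a b : J, a <> b.

Definition base := papp L J.
Definition interp := set base.

(* Meaningful only for size I = natoms Q: I is then cut at natoms Q1 in the
   conjunction case and has exactly one component in the atom case. *)
Fixpoint Sol (Q : query L) (I : seq interp) : set valuation :=
  match Q with
  | QTrue => setT
  | QFalse => set0
  | QEq s t => [set h | eval h s = eval h t]
  | QAtom A => if I is [:: I1] then [set h | I1 (papp_map (eval h) A)] else set0
  | QAnd Q1 Q2 => Sol Q1 (take (natoms Q1) I) `&` Sol Q2 (drop (natoms Q1) I)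
  | QEx x Q1 => [set h | exists d : J, Sol Q1 I (upd h x d)]
  end.

Definition leJ (Q Q' : query L) : Prop :=
  natoms Q = natoms Q' /\
  forall I : seq interp, size I = natoms Q -> Sol Q I `<=` Sol Q' I.

Definition eqJ (Q Q' : query L) : Prop :=
  natoms Q = natoms Q' /\
  forall I : seq interp, size I = natoms Q -> Sol Q I = Sol Q' I.

End Semantics.

Definition leQ (L : language) (Q Q' : query L) : Prop :=
  forall K : preinterp L, FEA_model K -> leJ K Q Q'.

Definition eqQ (L : language) (Q Q' : query L) : Prop :=
  leQ Q Q' /\ leQ Q' Q.

Section Solved.
Variable L : language.
Implicit Types (Q G : query L) (zs : seq var) (E : seq (var * term L))
  (As : seq (atom L)).

(* Conjunctions without parentheses associate to the right. *)
Fixpoint conj_seq (s : seq (query L)) : query L :=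
  match s with
  | [::] => QTrue
  | Q :: s' => if s' is [::] then Q else QAnd Q (conj_seq s')
  end.

(* x_1 = s_1 /\ ... /\ x_n = s_n /\ A_1 /\ ... /\ A_m, E listing the (x_i, s_i) *)
Definition matrix E As : query L :=
  conj_seq ([seq QEq (Var e.1) e.2 | e <- E] ++ [seq QAtom A | A <- As]).

Definition prenex zs E As : query L := foldr QEx (matrix E As) zs.

(* The case n = m = 0 forces k = 0, and then [prenex] is [QTrue]. *)
Definition solved_data zs E As : Prop :=
  [/\ uniq ([seq e.1 | e <- E] ++ zs),
      forall e, List.In e E ->
        (forall e', List.In e' E -> ~ occurs e.1 e'.2) /\
        (forall A, List.In A As -> ~ occurs_atom e.1 A),
      forall z, z \in zs -> free z (matrix E As)
    & forall z e, z \in zs -> List.In e E -> e.2 <> Var z].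

Definition solved Q : Prop :=
  [\/ Q = QTrue, Q = QFalse
    | exists zs E As, solved_data zs E As /\ Q = prenex zs E As].

Inductive variant_step : query L -> query L -> Prop :=
| variant_here x y G : ~ free y G -> substitutable x y G ->
    variant_step (QEx x G) (QEx y (rename (upd id x y) G))
| variant_andl Q1 Q1' Q2 : variant_step Q1 Q1' ->
    variant_step (QAnd Q1 Q2) (QAnd Q1' Q2)
| variant_andr Q1 Q2 Q2' : variant_step Q2 Q2' ->
    variant_step (QAnd Q1 Q2) (QAnd Q1 Q2')
| variant_ex x Q1 Q1' : variant_step Q1 Q1' ->
    variant_step (QEx x Q1) (QEx x Q1').

Definition variant : query L -> query L -> Prop :=
  clos_refl_trans (query L) variant_step.

(* The simultaneous exchange of u and v for all pairs (u, v) of uv. *)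
Definition swap (uv : seq (var * var)) (w : var) : var :=
  foldr (fun p r => if w == p.1 then p.2 else if w == p.2 then p.1 else r) w uv.

(* [elem_perm] and [elem_swap] relate [QTrue] only to itself; on [QFalse] the
   elementary transformations are trivial as well. *)
Inductive elementary : query L -> query L -> Prop :=
| elem_perm zs zs' E E' As : solved_data zs E As ->
    Permutation zs zs' -> Permutation E E' ->
    elementary (prenex zs E As) (prenex zs' E' As)
| elem_variant Q Q' : solved Q -> variant Q Q' -> elementary Q Q'
| elem_swap zs E As (uv : seq (var * var)) : solved_data zs E As ->
    (forall p, p \in uv -> List.In (p.1, Var p.2) E) ->
    uniq [seq p.2 | p <- uv] ->
    elementary (prenex zs E As) (rename (swap uv) (prenex zs E As)).

Definition isomorphic : query L -> query L -> Prop :=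
  clos_refl_trans (query L) elementary.

End Solved.

(* Main.v *)
From mathcomp Require Import all_boot.
From mathcomp Require Import boolp classical_sets.
From Stdlib Require Import Relations Permutation.
Require Import Defs.

(* Transfer from J to a model K. A solution of Q in K is pulled back to the
   algebra of terms over K: a finite set of equations holding in K is respected
   by a section K -> terms, by acyclicity of K, and no unification is needed.
   For a term model over X, all maps X -> J together amount to one homomorphism
   into the power J^(X -> J), which is again a model since the axioms are Horn.
   A solution of Q' there is pulled back to terms in the same way; as no
   function symbol is onto J, the coordinate functions on X are not values of
   function symbols, so they behave as free variables.
   Isomorphism of solved forms. The canonical solutions of Q and Q' in a term
   model solve each other's query. Eliminated variables of Q that are not
   eliminated in Q' form equations x = u whose reversals are in Q', so they can
   be exchanged; then the two solutions induce mutually inverse bijections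
   between the bound variables. *)

Set Implicit Arguments.
Unset Strict Implicit.
Unset Printing Implicit Defensive.

Local Open Scope classical_set_scope.

Lemma In_mem (T : eqType) (x : T) (s : seq T) : List.In x s <-> x \in s.
Proof.
elim: s => [|y s IH] //=; rewrite inE; split.
  by case=> [->|/IH ->]; rewrite ?eqxx ?orbT.
by case/orP => [/eqP ->|/IH]; [left|right].
Qed.

Lemma In_cat (T : Type) (x : T) (s t : seq T) :
  List.In x (s ++ t) <-> List.In x s \/ List.In x t.
Proof. exact: List.in_app_iff. Qed.

Lemma In_map (T U : Type) (f : T -> U) (s : seq T) y :
  List.In y [seq f x | x <- s] <-> exists2 x, List.In x s & y = f x.
Proof.
elim: s => [|z s IH] /=; first by split=> // -[].
split=> [[<-|/IH [x xs ->]]|[x [->|xs] yx]]; first by exists z => //; left.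
- by exists x => //; right.
- by left.
- by right; apply/IH; exists x.
Qed.

(** * Terms over a set, sections and powers of models *)

Section Trees.
Variable L : language.

(** Variables of [term] are natural numbers, whereas the leaves here have to be elements of a model,
    of an arbitrary set, or variables tagged as free or bound. *)
Inductive tree (X : Type) : Type :=
| Leaf of X
| Node (f : fsym L) of {ffun 'I_(farity f) -> tree X}.

Fixpoint tree_induction (X : Type) (P : tree X -> Prop)
    (hL : forall x, P (Leaf x))
    (hN : forall f (a : {ffun 'I_(farity f) -> tree X}),
      (forall i, P (a i)) -> P (Node a)) t : P t :=
  match t with
  | Leaf x => hL x
  | Node f a => hN f a (fun i => tree_induction hL hN (a i))
  end.

Fixpoint term_induction (P : term L -> Prop) (hV : forall x, P (Var x))
    (hA : forall f (a : {ffun 'I_(farity f) -> term L}),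
      (forall i, P (a i)) -> P (App f a)) t : P t :=
  match t with
  | Var x => hV x
  | App f a => hA f a (fun i => term_induction hV hA (a i))
  end.

(** Symbols form an arbitrary type; deciding their equality classically yields injectivity of
    dependent pairs over it. *)
Lemma ffun_pair_inj (I : Type) (n : I -> nat) (T : Type) f
    (a b : {ffun 'I_(n f) -> T}) :
  existT (fun f => {ffun 'I_(n f) -> T}) f a = existT _ f b -> a = b.
Proof. by apply: Eqdep_dec.inj_pair2_eq_dec => x y; apply: pselect. Qed.

Lemma Node_inj X f (a b : {ffun 'I_(farity f) -> tree X}) :
  Node a = Node b -> a = b.
Proof. by move=> e; injection e; apply: ffun_pair_inj. Qed.

Lemma PApp_inj T p (a b : {ffun 'I_(parity p) -> T}) :
  PApp (L := L) a = PApp b -> a = b.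
Proof. by move=> e; injection e; apply: ffun_pair_inj. Qed.

Definition tree_model X (iX : inhabited X) : preinterp L :=
  @PreInterp L (tree X) (let: inhabits x := iX in inhabits (Leaf x))
    (fun f a => Node a).

Fixpoint teval (K : preinterp L) X (g : X -> K) (t : tree X) : K :=
  match t with
  | Leaf x => g x
  | Node f a => fint [ffun i => teval g (a i)]
  end.

Fixpoint leaves X (t : tree X) : seq X :=
  match t with
  | Leaf x => [:: x]
  | Node f a => flatten [seq leaves (a i) | i <- enum 'I_(farity f)]
  end.

Fixpoint depth X (t : tree X) : nat :=
  match t with
  | Leaf x => 0
  | Node f a => (\max_i depth (a i)).+1
  end.

Lemma In_leaves_Node X f (a : {ffun 'I_(farity f) -> tree X}) x :
  List.In x (leaves (Node a)) <-> exists i, List.In x (leaves (a i)).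
Proof.
rewrite /= -[flatten _]/(List.concat _) List.in_concat; split.
  by case=> s [] /In_map [i _ ->]; exists i.
case=> i xi; exists (leaves (a i)); split=> //; apply/In_map.
by exists i => //; apply/In_mem; rewrite mem_enum.
Qed.

Lemma eq_eval (K : preinterp L) (h h' : var -> K) t :
  (forall x, occurs x t -> h x = h' x) -> eval h t = eval h' t.
Proof.
elim/term_induction: t => [x|f a IH] /= H; first exact: H.
congr fint; apply/ffunP => i; rewrite !ffunE; apply: IH => x xi.
by apply: H; exists i.
Qed.

Lemma eq_teval (K : preinterp L) X (g g' : X -> K) t :
  (forall x, List.In x (leaves t) -> g x = g' x) -> teval g t = teval g' t.
Proof.
elim/tree_induction: t => [x|f a IH] H; first by apply: H; left.
rewrite /=; congr fint; apply/ffunP => i; rewrite !ffunE; apply: IH => x xi.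
by apply: H; apply/In_leaves_Node; exists i.
Qed.

Definition hom (K1 K2 : preinterp L) (s : K1 -> K2) : Prop :=
  forall (f : fsym L) (a : {ffun 'I_(farity f) -> K1}),
    s (fint a) = fint [ffun i => s (a i)].

Lemma hom_eval (K1 K2 : preinterp L) (s : K1 -> K2) h t :
  hom s -> s (eval h t) = eval (s \o h) t.
Proof.
move=> hs; elim/term_induction: t => [x|f a IH] //=.
by rewrite hs; congr fint; apply/ffunP => i; rewrite !ffunE IH.
Qed.

Lemma hom_teval (K1 K2 : preinterp L) (s : K1 -> K2) X (g : X -> K1) t :
  hom s -> s (teval g t) = teval (s \o g) t.
Proof.
move=> hs; elim/tree_induction: t => [x|f a IH] //=.
by rewrite hs; congr fint; apply/ffunP => i; rewrite !ffunE IH.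
Qed.

Lemma teval_hom (K : preinterp L) X (iX : inhabited X) (g : X -> K) :
  hom (K1 := tree_model iX) (teval g).
Proof. by []. Qed.

Lemma tevalL X (iX : inhabited X) t :
  teval (K := tree_model iX) (@Leaf X) t = t.
Proof.
elim/tree_induction: t => [x|f a IH] //=.
by congr Node; apply/ffunP => i; rewrite ffunE IH.
Qed.

Lemma depth_occurs X (iX : inhabited X) (h : valuation (tree_model iX)) x t :
  occurs x t -> t <> Var x -> depth (h x) < depth (eval h t).
Proof.
elim/term_induction: t => [y|f a IH] /=; first by move=> ->.
case=> i xi _; rewrite ltnS; apply: leq_trans (leq_bigmax i).
rewrite ffunE; case: (pselect (a i = Var x)) => [->//|ne].
exact/ltnW/IH.
Qed.

Lemma tree_model_FEA X (iX : inhabited X) : FEA_model (tree_model iX).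
Proof.
split=> [f a b|f g a b fg|x t ne xt h].
- split=> [/Node_inj ->//|ab]; congr Node; exact/ffunP.
- by split=> // -[/fg].
- split=> // e; have := @depth_occurs X iX h x t xt ne.
  by rewrite -e ltnn.
Qed.

Definition power_model (K : preinterp L) (I : Type) : preinterp L :=
  @PreInterp L (I -> K)
    (let: inhabits d := dom_inhabited K in inhabits (fun _ => d))
    (fun f a g => fint [ffun i => a i g]).

Lemma power_proj_hom (K : preinterp L) I (g : I) :
  hom (K1 := power_model K I) (fun k => k g).
Proof. by []. Qed.

Lemma power_model_FEA (K : preinterp L) I :
  inhabited I -> FEA_model K -> FEA_model (power_model K I).
Proof.
case=> g0 [inj disj occ]; split=> [f a b|f g a b fg|x t ne xt h].
- split=> [e i|ab]; last by congr fint; apply/ffunP.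
  apply/funext => g; have /inj/(_ i) := congr1 (fun k => k g) e.
  by rewrite !ffunE.
- by split=> // /(congr1 (fun k => k g0)) /(disj _ _ _ _ fg).
- split=> // /(congr1 (fun k => k g0)).
  rewrite (hom_eval _ _ (power_proj_hom (K := K) g0)).
  by move/(occ _ _ ne xt (fun y => h y g0)).
Qed.

Fixpoint term_of X (c : X -> var) (t : tree X) : term L :=
  match t with
  | Leaf x => Var (c x)
  | Node f a => App f [ffun i => term_of c (a i)]
  end.

Lemma eval_term_of (K : preinterp L) X (c : X -> var) (h : var -> K) t :
  eval h (term_of c t) = teval (h \o c) t.
Proof.
elim/tree_induction: t => [x|f a IH] //=.
by congr fint; apply/ffunP => i; rewrite !ffunE IH.
Qed.

Lemma occurs_term_of X (c : X -> var) x t :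
  List.In x (leaves t) -> occurs (c x) (term_of c t).
Proof.
elim/tree_induction: t => [y|f a IH]; first by case=> [->|].
by case/In_leaves_Node => i /IH xi; exists i; rewrite ffunE.
Qed.

(** Numbering the finitely many leaves turns the tree into a term over [var]; the occurs axiom
    applies to it under the valuation [h] that reads the numbers back. *)
Lemma FEA_acyclic (K : preinterp L) f (a : {ffun 'I_(farity f) -> tree K}) d :
  FEA_model K -> List.In d (leaves (Node a)) -> teval id (Node a) <> d.
Proof.
move=> FK dt; pose l : seq {classic K} := leaves (Node a).
pose c (k : K) := index (k : {classic K}) l; pose h x : K := nth d l x.
have hc : forall k, List.In k (leaves (Node a)) -> h (c k) = k.
  by move=> k /(@In_mem {classic K}) kl; exact: (@nth_index {classic K}).
have := FEA_occ FK (x := c d) (t := term_of c (Node a)) _ _ h.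
rewrite hc // eval_term_of (@eq_teval K K (h \o c) id _ hc) => H /esym.
by apply H => //; apply: occurs_term_of.
Qed.

(** * Maps that commute with finitely many applications *)

Definition fapp (T : Type) := {f : fsym L & {ffun 'I_(farity f) -> T}}.

Definition fapp_val (K : preinterp L) (e : fapp K) : K := fint (projT2 e).

(** The homomorphism condition is imposed only at the listed applications: a section of evaluation
    can satisfy it there, though in general not everywhere. *)
Definition respects (K1 K2 : preinterp L) (s : K1 -> K2) (l : seq (fapp K1)) :=
  forall e, List.In e l -> s (fapp_val e) = fint [ffun i => s (projT2 e i)].

Lemma respects_cat (K1 K2 : preinterp L) (s : K1 -> K2) l1 l2 :
  respects s (l1 ++ l2) <-> respects s l1 /\ respects s l2.
Proof.
split=> [H|[H1 H2] e /In_cat[/H1|/H2]//].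
by split=> e el; apply: H; apply/In_cat; [left|right].
Qed.

Lemma FEA_fapp_inj (K : preinterp L) (e e' : fapp K) :
  FEA_model K -> fapp_val e = fapp_val e' -> e = e'.
Proof.
move=> FK; case: e e' => [f a] [g b]; rewrite /fapp_val /=.
case: (pselect (f = g)) => [fg|fg /(FEA_disj FK _ _ fg)//].
by case: _ / fg b => b /(FEA_inj FK) /ffunP ->.
Qed.

(** Induction on [l]. By injectivity and disjointness, the value d0 of a new application f(a) is the
    value of no listed one, so s d0 is still a leaf; substituting the tree f(s a) for that leaf
    everywhere makes the new application respected. The last clause keeps the induction going and
    later keeps coordinate functions as leaves. *)
Lemma FEA_section (K : preinterp L) (l : seq (fapp K)) : FEA_model K ->
  exists s : K -> tree K,
    [/\ forall d, teval id (s d) = d,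
        respects (K2 := tree_model (dom_inhabited K)) s l &
        forall d, (forall e, List.In e l -> fapp_val e <> d) -> s d = Leaf d].
Proof.
move=> FK; elim: l => [|e0 l [s [sK sl sL]]].
  by exists (@Leaf K); split=> // e [].
have [e0l|e0l] := pselect (List.In e0 l).
  exists s; split=> // [e [<-|]|d H]; try exact: sl.
  by apply: sL => e el; apply: H; right.
case: e0 e0l => f a e0l; set d0 := fapp_val (existT _ f a).
have sd0 : s d0 = Leaf d0.
  by apply: sL => e el /(FEA_fapp_inj FK) ee; apply: e0l; rewrite -ee.
pose u : tree K := Node [ffun i => s (a i)].
have uK : teval id u = d0.
  by rewrite /=; congr fint; apply/ffunP => i; rewrite !ffunE sK.
pose r d : tree K := if pselect (d = d0) is left _ then u else Leaf d.
have rE d : d <> d0 -> r d = Leaf d by rewrite /r; case: pselect.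
have r0 : r d0 = u by rewrite /r; case: pselect.
pose M := tree_model (dom_inhabited K).
(* Substitution is a homomorphism of trees, so the older applications remain respected. *)
exists (fun d => teval (K := M) r (s d)); split.
- move=> d; rewrite -[RHS]sK (@hom_teval M K (teval id) K r) //.
  apply: eq_teval => x _ /=.
  by case: (pselect (x = d0)) => [->|/rE->//]; rewrite r0.
- move=> e [<-|el] /=; last first.
    by rewrite sl //=; congr Node; apply/ffunP => i; rewrite !ffunE.
  rewrite -/d0 sd0 /= r0; congr Node; apply/ffunP => i; rewrite !ffunE.
  (* A leaf d0 in some s (a i) would lie in a node tree with value d0, against acyclicity; hence the
     substitution fixes these trees. *)
  rewrite -[LHS](tevalL (dom_inhabited K)); apply: (@eq_teval M) => x xi.
  rewrite rE // => xd; apply: (@FEA_acyclic K f [ffun i => s (a i)] d0) => //.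
  by apply/In_leaves_Node; exists i; rewrite ffunE -xd.
- move=> d H; rewrite sL => [|e el]; last by apply: H; right.
  by rewrite /= rE // => dd0; apply: (H (existT _ f a)); [left|].
Qed.

(** The list is fixed before the target K2 and the map s are known, so that s can be constructed for
    it afterwards. *)
Lemma choice_lists (K1 : preinterp L) (T : Type) (ts : seq T)
    (P : T -> forall K2 : preinterp L, (K1 -> K2) -> Prop) :
  (forall t, exists l, forall (K2 : preinterp L) (s : K1 -> K2),
    respects s l -> P t K2 s) ->
  exists l, forall (K2 : preinterp L) (s : K1 -> K2), respects s l ->
    forall t, List.In t ts -> P t K2 s.
Proof.
move=> H; elim: ts => [|t ts [l IH]]; first by exists [::].
have [l' Hl'] := H t; exists (l' ++ l) => K2 s /respects_cat[s1 s2] t' [<-|].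
  exact: Hl'.
exact: IH.
Qed.

Lemma respects_teval (K1 : preinterp L) X (g : X -> K1) (t : tree X) :
  exists l, forall (K2 : preinterp L) (s : K1 -> K2), respects s l ->
    s (teval g t) = teval (s \o g) t.
Proof.
elim/tree_induction: t => [x|f a IH]; first by exists [::].
have [l Hl] := choice_lists (enum 'I_(farity f)) IH.
exists (existT _ f [ffun i => teval g (a i)] :: l) => K2 s H /=.
rewrite (H (existT _ f _)) /=; last by left.
congr fint; apply/ffunP => i; rewrite !ffunE; apply: Hl.
  by move=> e el; apply: H; right.
by apply/In_mem; rewrite mem_enum.
Qed.

Definition tree_of (t : term L) : tree var :=
  eval (J := tree_model (inhabits (0 : var))) (@Leaf var) t.

Lemma teval_tree_of (K : preinterp L) (h : var -> K) t :
  teval h (tree_of t) = eval h t.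
Proof. by rewrite /tree_of hom_eval. Qed.

Lemma respects_eval (K1 : preinterp L) (h : var -> K1) (t : term L) :
  exists l, forall (K2 : preinterp L) (s : K1 -> K2), respects s l ->
    s (eval h t) = eval (s \o h) t.
Proof.
have [l Hl] := respects_teval h (tree_of t).
by exists l => K2 s /Hl; rewrite !teval_tree_of.
Qed.

(** * Transfer between models *)

Lemma papp_map_eq (T T' : Type) (g g' : T -> T') (A : papp L T) :
  (forall i, g (args A i) = g' (args A i)) -> papp_map g A = papp_map g' A.
Proof. by move=> gg; congr PApp; apply/ffunP => i; rewrite !ffunE. Qed.

Lemma papp_map_comp (T T' T'' : Type) (g : T -> T') (g' : T' -> T'')
    (A : papp L T) :
  papp_map g' (papp_map g A) = papp_map (g' \o g) A.
Proof. by congr PApp; apply/ffunP => i; rewrite !ffunE. Qed.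

Lemma papp_map_id (T : Type) (A : papp L T) : papp_map id A = A.
Proof. by case: A => p a; congr PApp; apply/ffunP => i; rewrite !ffunE. Qed.

Lemma comp_upd (T T' : Type) (s : T -> T') (h : var -> T) x d :
  s \o upd h x d = upd (s \o h) x (s d).
Proof. by apply/funext => y; rewrite /upd /=; case: ifP. Qed.

Lemma eq_Sol (K : preinterp L) (Q : query L) (I : seq (interp K))
    (h h' : valuation K) :
  (forall x, free x Q -> h x = h' x) -> Sol Q I h -> Sol Q I h'.
Proof.
elim: Q I h h' => [||s t|A|Q1 IH1 Q2 IH2|x Q IH] I h h' hh' //=.
- by rewrite (@eq_eval K h h' s) ?(@eq_eval K h h' t) // => x xs; apply: hh';
    [right|left].
- case: I => [|I0 []] //; rewrite /= (@papp_map_eq _ _ _ (eval h')) //.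
  by move=> i; apply: eq_eval => x xi; apply: hh'; exists i.
- case=> S1 S2; split; [apply: IH1 S1|apply: IH2 S2] => x xQ; apply: hh'.
    by left.
  by right.
- case=> d S; exists d; apply: IH S => y yQ; rewrite /upd; case: eqP => // yx.
  exact: hh'.
Qed.

(** Each atom occurrence has an interpretation of its own, so a solution uses one base element per
    occurrence. Sequences of singletons therefore suffice, and they can be moved along any map of
    domains. *)
Definition singles (K : preinterp L) (bs : seq (base K)) : seq (interp K) :=
  [seq [set b] | b <- bs].

Lemma singles_take (K : preinterp L) n (bs : seq (base K)) :
  take n (singles bs) = singles (take n bs).
Proof. by rewrite /singles map_take. Qed.

Lemma singles_drop (K : preinterp L) n (bs : seq (base K)) :
  drop n (singles bs) = singles (drop n bs).
Proof. by rewrite /singles map_drop. Qed.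

Lemma Forall2_take T U (R : T -> U -> Prop) n s t :
  List.Forall2 R s t -> List.Forall2 R (take n s) (take n t).
Proof.
move=> H; elim: H n => [|x y s' t' Rxy H IH] [|n] //=; constructor => //.
Qed.

Lemma Forall2_drop T U (R : T -> U -> Prop) n s t :
  List.Forall2 R s t -> List.Forall2 R (drop n s) (drop n t).
Proof.
move=> H; elim: H n => [|x y s' t' Rxy H IH] [|n] //=; by constructor.
Qed.

Lemma Sol_to_singles (K : preinterp L) (Q : query L) I (h : valuation K) :
  size I = natoms Q -> Sol Q I h ->
  exists bs, [/\ size bs = natoms Q, List.Forall2 (fun b B => B b) bs I &
    Sol Q (singles bs) h].
Proof.
elim: Q I h => [||s t|A|Q1 IH1 Q2 IH2|x Q IH] I h /=.
- by move/size0nil => -> _; exists [::]; split=> //; constructor.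
- by [].
- by move/size0nil => -> st; exists [::]; split=> //; constructor.
- case: I => [|I0 []] //= _ AI; exists [:: papp_map (eval h) A].
  by split=> //; repeat constructor.
- move=> sI [S1 S2].
  have [|bs1 [s1 F1 {}S1]] := IH1 _ _ _ S1.
    by rewrite size_takel // sI leq_addr.
  have [|bs2 [s2 F2 {}S2]] := IH2 _ _ _ S2; first by rewrite size_drop sI addKn.
  exists (bs1 ++ bs2); split; first by rewrite size_cat s1 s2.
    by rewrite -[I](cat_take_drop (natoms Q1)); apply: List.Forall2_app.
  by rewrite singles_take singles_drop -s1 take_size_cat // drop_size_cat.
- move=> sI [d S]; have [bs [s F {}S]] := IH _ _ sI S.
  by exists bs; split=> //; exists d.
Qed.

Lemma Sol_of_singles (K : preinterp L) (Q : query L) I bs (h : valuation K) :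
  List.Forall2 (fun b B => B b) bs I -> Sol Q (singles bs) h -> Sol Q I h.
Proof.
elim: Q I bs h => [||s t|A|Q1 IH1 Q2 IH2|x Q IH] I bs h F //=.
- case: bs F => [|b [|b' bs]] //= F.
  by inversion F as [|b' B bs' I' Bb F' e1 e2]; inversion F' => /= ->.
- rewrite singles_take singles_drop => -[S1 S2]; split.
    by apply: IH1 S1; apply: Forall2_take.
  by apply: IH2 S2; apply: Forall2_drop.
- by case=> d S; exists d; apply: IH S.
Qed.

(** Queries are positive and existential, so the images of the witnesses are witnesses again;
    evaluating the terms of Q at the witnesses involves finitely many applications only. *)
Lemma respects_Sol (K1 : preinterp L) (Q : query L) bs (h : valuation K1) :
  Sol Q (singles bs) h ->
  exists l, forall (K2 : preinterp L) (s : K1 -> K2), respects s l ->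
    Sol Q (singles [seq papp_map s b | b <- bs]) (s \o h).
Proof.
elim: Q bs h => [||t1 t2|A|Q1 IH1 Q2 IH2|x Q IH] bs h /=.
- by exists [::].
- by [].
- move=> e; have [l1 H1] := respects_eval h t1.
  have [l2 H2] := respects_eval h t2.
  by exists (l1 ++ l2) => K2 s /respects_cat[/H1 <- /H2 <-]; rewrite e.
- case: bs => [|b []] //= Ab.
  have [l Hl] := choice_lists (enum 'I_(parity (head A)))
    (fun i => respects_eval h (args A i)).
  exists l => K2 s /Hl {}Hl; rewrite /set1 /= -Ab papp_map_comp.
  apply: papp_map_eq => i /=; rewrite Hl //.
  by apply/In_mem; rewrite mem_enum.
- rewrite singles_take singles_drop => -[/IH1[l1 H1] /IH2[l2 H2]].
  exists (l1 ++ l2) => K2 s /respects_cat[/H1 {}H1 /H2 {}H2].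
  by rewrite singles_take singles_drop -map_take -map_drop.
- case=> d /IH[l Hl]; exists l => K2 s /Hl {}Hl; exists (s d).
  by rewrite -comp_upd.
Qed.

Lemma hom_Sol (K1 K2 : preinterp L) (s : K1 -> K2) (Q : query L) bs
    (h : valuation K1) :
  hom s -> Sol Q (singles bs) h ->
  Sol Q (singles [seq papp_map s b | b <- bs]) (s \o h).
Proof. by move=> hs /respects_Sol[l]; apply=> e _; apply: hs. Qed.

Lemma power_papp_eq T I (i0 : I) (A B : papp L (I -> T)) :
  (forall g, papp_map (fun k => k g) A = papp_map (fun k => k g) B) -> A = B.
Proof.
case: A B => [p a] [q b] H; have /(congr1 (@head _ _)) /= pq := H i0.
case: _ / pq b H => b H; congr PApp; apply/ffunP => i; apply/funext => g.
by have /PApp_inj/ffunP/(_ i) := H g; rewrite !ffunE.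
Qed.

(** The witnesses found in the single coordinates are assembled, by choice, into one element of the
    power. The coordinate [i0] refutes [QFalse] and sequences of the wrong length. *)
Lemma power_Sol (K : preinterp L) I (i0 : I) (Q : query L)
    (bs : seq (base (power_model K I))) (h : valuation (power_model K I)) :
  (forall g, Sol Q (singles (K := K) [seq papp_map (fun k => k g) b | b <- bs])
                 (fun x => h x g)) ->
  Sol Q (singles bs) h.
Proof.
have ev g t : eval (fun x => h x g) t = eval h t g.
  by rewrite (hom_eval h t (power_proj_hom (K := K) g)).
elim: Q bs h ev => [||s t|A|Q1 IH1 Q2 IH2|x Q IH] bs h ev H /=.
- by [].
- exact: H i0.
- by apply/funext => g; rewrite -!ev; apply: H.
- case: bs H => [|b [|b' bs]] H /=; try exact: (H i0).
  apply: (power_papp_eq i0) => g; rewrite papp_map_comp -[RHS](H g).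
  by apply: papp_map_eq => i; rewrite ev.
- rewrite singles_take singles_drop; split.
    by apply: IH1 => // g; case: (H g) => + _; rewrite singles_take -map_take.
  by apply: IH2 => // g; case: (H g) => _; rewrite singles_drop -map_drop.
- have [d Hd] := choice H; exists d; apply: IH => [g t|g].
    by rewrite (hom_eval _ t (power_proj_hom (K := K) g)).
  apply: eq_Sol (Hd g) => y _; rewrite /upd; by case: ifP.
Qed.

Lemma free_bound (Q : query L) : exists n, forall x, free x Q -> x < n.
Proof.
have term_bound (t : term L) : exists n, forall x, occurs x t -> x < n.
  elim/term_induction: t => [y|f a IH]; first by exists y.+1 => x /= ->.
  have [n Hn] := choice IH; exists (\max_i n i) => x [i /Hn xi].
  exact: leq_trans xi (leq_bigmax i).
elim: Q => [||s t|A|Q1 [n1 H1] Q2 [n2 H2]|x Q [n H]].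
- by exists 0.
- by exists 0.
- have [[n1 H1] [n2 H2]] := (term_bound s, term_bound t).
  by exists (maxn n1 n2) => x [/H1|/H2] xn; rewrite leq_max xn ?orbT.
- have [n Hn] := choice (fun i => term_bound (args A i)).
  exists (\max_i n i) => x [i /Hn xi]; exact: leq_trans xi (leq_bigmax i).
- by exists (maxn n1 n2) => x [/H1|/H2] xn; rewrite leq_max xn ?orbT.
- by exists n => y [_ /H].
Qed.

Lemma injective_cancel (X Y : Type) (f : X -> Y) : inhabited X ->
  injective f -> exists g, cancel f g.
Proof.
case=> x0 fI; have /choice [g gE] y : exists x, forall x', f x' = y -> x' = x.
  have [[x <-]|N] := pselect (exists x, f x = y); first by exists x => x' /fI.
  by exists x0 => x' e; case: N; exists x'.
by exists g => x; rewrite -(gE (f x) x).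
Qed.

(** A constant has a single value and so misses an element of a non-trivial J; every other symbol
    misses the value of that constant, by disjointness. *)
Lemma FEA_not_onto (J : preinterp L) : (exists c : fsym L, farity c = 0) ->
  FEA_model J -> nontrivial J ->
  forall f : fsym L, exists d : J, forall a : {ffun 'I_(farity f) -> J},
    fint a <> d.
Proof.
case=> c c0 FJ [d1 [d2 d12]] f.
have [d dN] : exists d : J, forall a : {ffun 'I_(farity c) -> J}, fint a <> d.
  apply: contrapT => /forallNP N.
  have /= all_c d : exists a : {ffun 'I_(farity c) -> J}, fint a = d.
    by apply: contrapT => M; case: (N d) => a ad; apply: M; exists a.
  have [[a1 a1E] [a2 a2E]] := (all_c d1, all_c d2).
  apply: d12; rewrite -a1E -a2E; congr fint; apply/ffunP => i.
  by have := ltn_ord i; rewrite {2}c0.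
have [<-|fc] := pselect (c = f); first by exists d.
pose a0 : {ffun 'I_(farity c) -> J} := [ffun=> d].
by exists (fint a0) => a /(FEA_disj FJ) H; apply: H => e; apply: fc.
Qed.

(** * From one non-trivial model to all models *)

Section Lifting.
Variables (J : preinterp L) (Q Q' : query L).
Hypotheses (hL : exists c : fsym L, farity c = 0).
Hypotheses (FJ : FEA_model J) (ntJ : nontrivial J) (leQQ' : leJ J Q Q').

Lemma leJ_tree X (iX : inhabited X) bs (h : valuation (tree_model iX)) :
  size bs = natoms Q -> Sol Q (singles bs) h -> Sol Q' (singles bs) h.
Proof.
(* Coordinate g of P is reserved for the homomorphism [teval g] into J; [E] below collects all of
   these. *)
move=> sbs Qh; pose P := power_model J (X -> J).
have [d0] := dom_inhabited J; pose g0 : X -> J := fun _ => d0.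
have FP : FEA_model P by apply: power_model_FEA => //; exists.
pose proj x : P := fun g => g x.
(* Two distinct elements of J give a map g that separates x from y, so [proj] is injective. *)
have [r projK] : exists r, cancel proj r.
  apply: injective_cancel => // x y exy; have [d1 [d2 d12]] := ntJ.
  apply: contrapT => xy; apply: d12.
  pose g z := if `[< z = x >] then d1 else d2.
  have <- : g x = d1 by rewrite /g asboolT.
  have <- : g y = d2 by rewrite /g asboolF // => yx; apply: xy.
  exact: (congr1 (fun k : P => k g) exy).
pose E := teval (K := P) proj.
(* In coordinate g the solution of Q is carried into J by [teval g], where the hypothesis turns it
   into a solution of Q'. *)
have EP : Sol Q' (singles [seq papp_map E b | b <- bs]) (E \o h).
  apply: (power_Sol g0) => g; rewrite -map_comp.
  have gE t : E t g = teval g t.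
    exact: (hom_teval (K1 := P) proj t (power_proj_hom (K := J) g)).
  have /leQQ'.2 H : size (singles [seq papp_map (teval g) b | b <- bs]) =
      natoms Q.
    by rewrite !size_map.
  move: (H _ (hom_Sol (@teval_hom J X iX g) Qh)); congr (Sol Q' (singles _) _).
    by apply: eq_map => b /=; rewrite papp_map_comp; apply: papp_map_eq => i /=.
  by apply/funext => x /=; rewrite gE.
have [l1 Hl1] := respects_Sol EP.
have [n Hn] := free_bound Q'.
(* The trees to be recovered from P: the values of [h] at the variables below the bound n, and the
   arguments of [bs]. *)
pose ts : seq (tree X) := [seq h x | x <- iota 0 n] ++
  flatten [seq codom (args b) | b <- bs].
have [l2 Hl2] := choice_lists ts (respects_teval (K1 := P) proj).
have [s [sK sl sL]] := FEA_section (l1 ++ l2) FP.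
move: sl => /respects_cat [/Hl1 {}Hl1 /Hl2 {}Hl2].
(* At the constant map d the element [proj x] takes the value d. For d outside the range of f in J,
   this shows that [proj x] is not a value of f. *)
have sproj x : s (proj x) = Leaf (proj x).
  apply: sL => -[f a] _ e; have [d dN] := FEA_not_onto hL FJ ntJ f.
  exact: (dN _ (congr1 (fun k : P => k (fun _ => d)) e)).
(* Relabelling leaves by [r] undoes s and [E] on [ts]; being a homomorphism, [R] brings the solution
   of Q' back to trees over X. *)
pose R : tree_model (dom_inhabited P) -> tree_model iX :=
  teval (K := tree_model iX) (fun k => Leaf (r k)).
have RsE t : List.In t ts -> R (s (E t)) = t.
  move=> /Hl2 ->; rewrite /R hom_teval // -[RHS](tevalL iX).
  by apply: (@eq_teval (tree_model iX)) => x _ /=; rewrite sproj /= projK.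
have := hom_Sol (s := R) _ Hl1 => /(_ (fun f a => erefl)).
have -> : [seq papp_map R b | b <- [seq papp_map s b |
             b <- [seq papp_map E b | b <- bs]]] = bs.
  rewrite -!map_comp -[RHS]map_id; apply: List.map_ext_in => b bbs /=.
  rewrite !papp_map_comp -[RHS]papp_map_id; apply: papp_map_eq => i.
  apply: RsE; apply/In_cat; right; apply/List.in_concat.
  exists (codom (args b)); split; first by apply/In_map; exists b.
  rewrite /codom /image_mem; apply/In_map; exists i => //.
  by apply/In_mem; rewrite mem_enum.
apply: eq_Sol => x /Hn xn; apply: RsE; apply/In_cat; left; apply/In_map.
by exists x => //; apply/In_mem; rewrite mem_iota.
Qed.

(** The term model over X = K is used: a section moves the solution from K to trees over K, and
    evaluating every leaf as itself moves the solution of Q' back. *)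
Lemma leJ_leQ : leQ Q Q'.
Proof.
move=> K FK; split=> [|I sI h /(Sol_to_singles sI) [bs [sbs F S]]].
  exact: leQQ'.1.
apply: Sol_of_singles F _; have [l Hl] := respects_Sol S.
have [s [sK /Hl {}Hl _]] := FEA_section l FK.
have sz : size [seq papp_map s b | b <- bs] = natoms Q by rewrite size_map.
move: (hom_Sol (@teval_hom K K (dom_inhabited K) id) (leJ_tree sz Hl)).
congr (Sol Q' (singles _) _); last by apply/funext => x /=.
rewrite -map_comp -[RHS]map_id; apply: eq_map => b /=.
by rewrite papp_map_comp -[RHS]papp_map_id; apply: papp_map_eq => i /=.
Qed.

End Lifting.

Lemma eqJ_leJ (J : preinterp L) (Q Q' : query L) :
  eqJ J Q Q' <-> leJ J Q Q' /\ leJ J Q' Q.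
Proof.
split=> [[n H]|[[n H1] [_ H2]]].
  split; split=> // I sI; first by rewrite H.
  by rewrite H // sI.
split=> // I sI; apply/seteqP; split; first exact: H1.
by apply: H2; rewrite sI.
Qed.

End Trees.

(** * Solved forms: semantics, renaming and variants *)

Lemma uniq_NoDup (T : eqType) (s : seq T) : uniq s <-> List.NoDup s.
Proof.
elim: s => [|x s IH] /=; first by split=> // _; constructor.
split=> [/andP[xs /IH sU]|H]; first by constructor => // /In_mem; apply/negP.
by inversion H; apply/andP; split; [apply/negP => /In_mem|apply/IH].
Qed.

Lemma In_functional (T : eqType) (U : Type) (s : seq (T * U)) x u u' :
  uniq [seq e.1 | e <- s] -> List.In (x, u) s -> List.In (x, u') s -> u = u'.
Proof.
elim: s => [|[y v] s IH] //= /andP[ys sU].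
have N w : List.In (y, w) s -> False.
  by move=> yw; case/negP: ys; apply/In_mem/In_map; exists (y, w).
case=> [e|xu] [e'|xu'].
- by case: e e' => _ <- [].
- by case: e => yx _; case: (N u'); rewrite yx.
- by case: e' => yx _; case: (N u); rewrite yx.
- exact: IH xu xu'.
Qed.

Section Solved.
Variable L : language.
Implicit Types (Q : query L) (zs : seq var) (E : seq (var * term L))
  (As : seq (atom L)).

Lemma natoms_prenex zs Q : natoms (foldr QEx Q zs) = natoms Q.
Proof. by elim: zs. Qed.

Lemma natoms_conj_cons Q s :
  natoms (conj_seq (Q :: s)) = natoms Q + natoms (conj_seq s).
Proof. by case: s => [|Q' s] //=; rewrite addn0. Qed.

Lemma natoms_matrix E As : natoms (matrix E As) = size As.
Proof.
elim: E => [|e E IH]; last by rewrite natoms_conj_cons.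
by elim: As => [|A As IH] //; rewrite natoms_conj_cons IH.
Qed.

Lemma Sol_prenex (K : preinterp L) zs Q I (h : valuation K) :
  Sol (foldr QEx Q zs) I h <->
  exists2 h' : valuation K, forall v, v \notin zs -> h' v = h v & Sol Q I h'.
Proof.
elim: zs h => [|z zs IH] h /=.
  split=> [S|[h' hh' S]]; first by exists h.
  by apply: eq_Sol S => x _; apply: hh'.
split=> [[d /IH[h' hh' S]]|[h' hh' S]].
  exists h' => // v; rewrite inE negb_or => /andP[vz /hh' ->].
  by rewrite /upd (negbTE vz).
exists (h' z); apply/IH; exists h' => // v vzs; rewrite /upd.
by case: eqP => [->//|/eqP vz]; apply: hh'; rewrite inE negb_or vz.
Qed.

(** [conj_seq] ends without a final [QTrue]; as far as solutions go, it may be treated as if it had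
    one. *)
Lemma Sol_conj_cons (K : preinterp L) Q s I (h : valuation K) :
  size I = natoms (conj_seq (Q :: s)) ->
  Sol (conj_seq (Q :: s)) I h <-> Sol (QAnd Q (conj_seq s)) I h.
Proof.
case: s => [|Q' s] //= sI; rewrite take_oversize ?sI //.
by split=> [|[]].
Qed.

Lemma Sol_matrix (K : preinterp L) E As (bs : seq (base K)) (h : valuation K) :
  size bs = size As ->
  Sol (matrix E As) (singles bs) h <->
  (forall e, List.In e E -> h e.1 = eval h e.2) /\
  bs = [seq papp_map (eval h) A | A <- As].
Proof.
move=> sbs; elim: E => [|[x t] E IH]; last first.
  have -> : matrix ((x, t) :: E) As =
    conj_seq (QEq (Var x) t :: ([seq QEq (Var e.1) e.2 | e <- E] ++
                               [seq QAtom A | A <- As])) by [].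
  rewrite Sol_conj_cons; last first.
    by rewrite natoms_conj_cons -/(matrix E As) natoms_matrix size_map.
  rewrite [Sol _ _ _]/= drop0 -/(matrix E As); split.
    by case=> xt /IH[Eh bsE]; split=> // e [<-|/Eh].
  case=> Eh bsE; split; first exact: (Eh (x, t) (or_introl erefl)).
  by apply/IH; split=> // e eE; apply: Eh; right.
rewrite /matrix /=; elim: As bs sbs => [|A As IH] [|b bs] //=.
move=> [sbs]; rewrite -/(conj_seq (QAtom A :: [seq QAtom A | A <- As])).
rewrite Sol_conj_cons; last first.
  by rewrite natoms_conj_cons -/(matrix [::] As) natoms_matrix /= size_map sbs.
rewrite [Sol _ _ _]/= take0 drop0 -/(singles bs); split.
  by case=> <- /(IH _ sbs)[_ ->].
by case=> _ [-> bsE]; split=> //; apply/(IH _ sbs).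
Qed.

(** The nested quantifiers and conjunctions are flattened: one valuation supplies the witnesses of
    the whole prefix at once. *)
Definition sat (K : preinterp L) zs E As (bs : seq (base K))
    (h : valuation K) :=
  exists h' : valuation K, [/\ forall v, v \notin zs -> h' v = h v,
    forall e, List.In e E -> h' e.1 = eval h' e.2 &
    bs = [seq papp_map (eval h') A | A <- As]].

Lemma satP (K : preinterp L) zs E As (bs : seq (base K)) h :
  size bs = size As ->
  Sol (prenex zs E As) (singles bs) h <-> sat zs E As bs h.
Proof.
move=> sbs; rewrite Sol_prenex; split.
  by case=> h' hh' /(Sol_matrix _ _ sbs) [H1 H2]; exists h'.
by case=> h' [hh' H1 H2]; exists h' => //; apply/Sol_matrix.
Qed.

Lemma sat_size (K : preinterp L) zs E As (bs : seq (base K)) h :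
  sat zs E As bs h -> size bs = size As.
Proof. by case=> h' [_ _ ->]; rewrite size_map. Qed.

Lemma leJ_sat (K : preinterp L) zs E As zs' E' As' (bs : seq (base K)) h :
  leJ K (prenex zs E As) (prenex zs' E' As') ->
  sat zs E As bs h -> sat zs' E' As' bs h.
Proof.
case; rewrite !natoms_prenex !natoms_matrix => sA le S; have sbs := sat_size S.
apply/satP; first by rewrite -sA.
by apply: le; [rewrite size_map|apply/satP].
Qed.

Lemma free_conj x (s : seq (query L)) :
  free x (conj_seq s) <-> exists2 Q, List.In Q s & free x Q.
Proof.
elim: s => [|Q s IH]; first by split=> // -[].
have -> : free x (conj_seq (Q :: s)) <-> free x Q \/ free x (conj_seq s).
  by case: s {IH} => //=; split=> [|[]] //; left.
rewrite IH; split=> [[xQ|[Q' ? ?]]|[Q' /= [->|Q's] xQ']].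
- by exists Q => //; left.
- by exists Q' => //; right.
- by left.
- by right; exists Q'.
Qed.

Lemma free_matrix x E As : free x (matrix E As) <->
  (exists2 e, List.In e E & x = e.1 \/ occurs x e.2) \/
  (exists2 A, List.In A As & occurs_atom x A).
Proof.
rewrite free_conj; split=> [[Q /In_cat[]/In_map[y yE ->] xQ]|[][y yE xy]].
- by left; exists y.
- by right; exists y.
- exists (QEq (Var y.1) y.2) => //.
  by apply/In_cat; left; apply/In_map; exists y.
- by exists (QAtom y) => //; apply/In_cat; right; apply/In_map; exists y.
Qed.

(** * Renaming and permuting solved forms *)

Lemma rename_conj r (s : seq (query L)) :
  rename r (conj_seq s) = conj_seq [seq rename r Q | Q <- s].
Proof.
elim: s => [|Q s IH] //; by case: s IH => [|Q' s] //= ->.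
Qed.

Definition ren_eqs (r : var -> var) E : seq (var * term L) :=
  [seq (r e.1, rename_term r e.2) | e <- E].

Definition ren_atoms (r : var -> var) As : seq (atom L) :=
  [seq papp_map (rename_term r) A | A <- As].

Lemma rename_matrix r E As :
  rename r (matrix E As) = matrix (ren_eqs r E) (ren_atoms r As).
Proof. by rewrite rename_conj /matrix map_cat -!map_comp. Qed.

Lemma upd_fix (r : var -> var) z : r z = z -> upd r z z = r.
Proof. by move=> rz; apply/funext => v; rewrite /upd; case: eqP => [->|]. Qed.

Lemma rename_prenex r zs Q : (forall z, z \in zs -> r z = z) ->
  rename r (foldr QEx Q zs) = foldr QEx (rename r Q) zs.
Proof.
elim: zs => [|z zs IH] //= H.
rewrite upd_fix; last by apply: H; rewrite inE eqxx.
by rewrite IH // => y yzs; apply: H; rewrite inE yzs orbT.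
Qed.

Lemma occurs_rename r x (t : term L) :
  occurs x (rename_term r t) <-> exists2 y, occurs y t & x = r y.
Proof.
elim/term_induction: t => [y|f a IH] /=.
  by split=> [->|[z ->]//]; exists y.
split=> [[i]|[y [i yi] xy]]; last first.
  by exists i; rewrite ffunE; apply/IH; exists y.
by rewrite ffunE => /IH[y yi ->]; exists y => //; exists i.
Qed.

Lemma occurs_atom_rename r x (A : atom L) :
  occurs_atom x (papp_map (rename_term r) A) <->
  exists2 y, occurs_atom y A & x = r y.
Proof.
split=> [[i]|[y [i yi] ->]].
  by rewrite ffunE => /occurs_rename[y yi ->]; exists y => //; exists i.
by exists i; rewrite ffunE; apply/occurs_rename; exists y.
Qed.

Lemma eval_rename (K : preinterp L) r (h : var -> K) t :
  eval h (rename_term r t) = eval (h \o r) t.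
Proof.
elim/term_induction: t => [y|f a IH] //=.
by congr fint; apply/ffunP => i; rewrite !ffunE IH.
Qed.

Lemma eq_rename r r' (t : term L) :
  (forall x, occurs x t -> r x = r' x) -> rename_term r t = rename_term r' t.
Proof.
elim/term_induction: t => [y|f a IH] H /=; first by rewrite H.
congr App; apply/ffunP => i; rewrite !ffunE.
by apply: IH => x xi; apply: H; exists i.
Qed.

Lemma rename_comp r r' (t : term L) :
  rename_term r' (rename_term r t) = rename_term (r' \o r) t.
Proof.
elim/term_induction: t => [y|f a IH] //=.
by congr App; apply/ffunP => i; rewrite !ffunE.
Qed.

Lemma Permutation_uniq (T : eqType) (s t : seq T) :
  Permutation s t -> uniq s -> uniq t.
Proof.
by move=> st /uniq_NoDup sU; apply/uniq_NoDup/(Permutation_NoDup st).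
Qed.

Lemma Permutation_mem (T : eqType) (s t : seq T) : Permutation s t -> s =i t.
Proof.
move=> st x; apply/idP/idP => /In_mem xs; apply/In_mem.
  exact: Permutation_in st xs.
exact: Permutation_in (Permutation_sym st) xs.
Qed.

Lemma solved_data_perm zs zs' E E' As :
  Permutation zs zs' -> Permutation E E' ->
  solved_data zs E As -> solved_data zs' E' As.
Proof.
move=> pz pE [U X Z S].
have EE' e : List.In e E' -> List.In e E by apply/Permutation_in/Permutation_sym.
have zz z : z \in zs' -> z \in zs by rewrite (Permutation_mem pz).
split.
- apply: Permutation_uniq U; apply: Permutation_app => //.
  exact: Permutation_map.
- by move=> e /EE' /X[X1 X2]; split=> // e' /EE' /X1.
- move=> z /zz /Z /free_matrix[[e eE ze]|zA]; apply/free_matrix; last by right.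
  by left; exists e => //; apply: Permutation_in eE.
- by move=> z e /zz zzs /EE' eE; apply: S.
Qed.

Lemma solved_data_rename r zs E As :
  injective r -> (forall z, z \in zs -> r z = z) -> solved_data zs E As ->
  solved_data zs (ren_eqs r E) (ren_atoms r As).
Proof.
move=> rI rz [U X Z S]; split.
- have -> : [seq e.1 | e <- ren_eqs r E] ++ zs =
    [seq r v | v <- [seq e.1 | e <- E] ++ zs].
    rewrite map_cat -!map_comp; congr (_ ++ _).
    by rewrite -[LHS]map_id; apply/eq_in_map => z /rz.
  by rewrite map_inj_uniq.
- move=> _ /In_map[e /X[X1 X2] ->]; split=> _ /In_map[y yE ->] /=.
    by case/occurs_rename => v ve /rI vE; apply: (X1 _ yE); rewrite vE.
  by case/occurs_atom_rename => v ve /rI vE; apply: (X2 _ yE); rewrite vE.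
- move=> z zzs; apply/free_matrix; rewrite -(rz z) //.
  case/free_matrix: (Z z zzs) => [][y yE zy]; [left|right].
    exists (r y.1, rename_term r y.2); first by apply/In_map; exists y.
    by case: zy => [->|zy]; [left|right; apply/occurs_rename; exists z].
  exists (papp_map (rename_term r) y); first by apply/In_map; exists y.
  by apply/occurs_atom_rename; exists z.
- move=> z _ zzs /In_map[e eE ->] /=; case E2 : e.2 => [u|//] /= [uz].
  by apply: (S z e zzs eE); rewrite E2; congr Var; apply: rI; rewrite uz rz.
Qed.

Lemma free_prenex x zs Q :
  free x (foldr QEx Q zs) <-> x \notin zs /\ free x Q.
Proof.
elim: zs => [|z zs IH] /=; first by split=> [|[]].
rewrite IH inE negb_or; split=> [[/eqP xz [xzs xQ]]|[/andP[/eqP xz xzs] xQ]].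
  by rewrite xz xzs.
by [].
Qed.

Lemma free_rename_matrix x r E As : free x (rename r (matrix E As)) ->
  exists2 y, free y (matrix E As) & x = r y.
Proof.
rewrite rename_matrix => /free_matrix[][_ /In_map[y yE ->]].
  case=> [->|/occurs_rename[v ve ->]].
    by exists y.1 => //; apply/free_matrix; left; exists y => //; left.
  by exists v => //; apply/free_matrix; left; exists y => //; right.
move=> /occurs_atom_rename[v vy ->]; exists v => //.
by apply/free_matrix; right; exists y.
Qed.

Lemma eq_rename_matrix r r' E As :
  (forall x, free x (matrix E As) -> r x = r' x) ->
  ren_eqs r E = ren_eqs r' E /\ ren_atoms r As = ren_atoms r' As.
Proof.
move=> H; split; apply: List.map_ext_in => y yE.
  congr pair; first by apply: H; apply/free_matrix; left; exists y => //; left.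
  apply: eq_rename => x xy.
  by apply: H; apply/free_matrix; left; exists y => //; right.
apply: papp_map_eq => i; apply: eq_rename => x xi.
by apply: H; apply/free_matrix; right; exists y => //; exists i.
Qed.

Lemma ren_eqs_comp r r' E : ren_eqs r' (ren_eqs r E) = ren_eqs (r' \o r) E.
Proof.
by rewrite /ren_eqs -map_comp; apply: eq_map => e /=; rewrite rename_comp.
Qed.

Lemma ren_atoms_comp r r' As :
  ren_atoms r' (ren_atoms r As) = ren_atoms (r' \o r) As.
Proof.
rewrite /ren_atoms -map_comp; apply: eq_map => A /=.
by rewrite papp_map_comp; apply: papp_map_eq => i /=; rewrite rename_comp.
Qed.

Lemma rename_id (t : term L) : rename_term id t = t.
Proof.
elim/term_induction: t => [//|f a IH] /=.
by congr App; apply/ffunP => i; rewrite ffunE.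
Qed.

Lemma ren_eqs_id E : ren_eqs id E = E.
Proof.
by rewrite -[RHS]map_id; apply: eq_map => -[x t] /=; rewrite rename_id.
Qed.

Lemma ren_atoms_id As : ren_atoms id As = As.
Proof.
rewrite -[RHS]map_id; apply: eq_map => A; rewrite -[RHS]papp_map_id.
by apply: papp_map_eq => i; rewrite rename_id.
Qed.

Lemma variant_foldr zs Q Q' :
  variant Q Q' -> variant (foldr QEx Q zs) (foldr QEx Q' zs).
Proof.
move=> QQ'; elim: zs => [|z zs IH] //=.
elim: IH => [P P' PP'|P|P P' P'' _ H _ H'].
- by apply: rt_step; apply: variant_ex.
- exact: rt_refl.
- exact: rt_trans H H'.
Qed.

Lemma substitutable_conj x y (s : seq (query L)) :
  (forall Q, List.In Q s -> substitutable x y Q) ->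
  substitutable x y (conj_seq s).
Proof.
elim: s => [|Q s IH] //= H; have HQ : substitutable x y Q by apply: H; left.
case: s IH H => [|Q' s] // IH H; split=> //.
by apply: IH => P Ps; apply: H; right.
Qed.

Lemma substitutable_prenex x y zs E As : y \notin zs ->
  substitutable x y (prenex zs E As).
Proof.
elim: zs => [_|z zs IH]; last first.
  by rewrite inE negb_or => /andP[/eqP yz /IH S] _; split=> // /esym.
by apply: substitutable_conj => Q /In_cat[]/In_map[e _ ->].
Qed.

(** The new names avoid the old prefix and the free variables of the matrix, so the quantifiers can
    be renamed one at a time, innermost first, without capture. *)
Lemma variant_prenex r zs E As :
  (forall v, v \notin zs -> r v = v) -> uniq zs -> uniq [seq r z | z <- zs] ->
  (forall z, z \in zs -> r z \notin zs /\ ~ free (r z) (matrix E As)) ->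
  variant (prenex zs E As)
    (prenex [seq r z | z <- zs] (ren_eqs r E) (ren_atoms r As)).
Proof.
elim: zs r => [|z zs IH] r rN /=.
  move=> _ _ _; have [-> ->] : ren_eqs r E = ren_eqs id E /\
      ren_atoms r As = ren_atoms id As.
    by apply: eq_rename_matrix => x _; apply: rN.
  rewrite ren_eqs_id ren_atoms_id.
  exact: rt_refl.
case/andP=> zzs zsU /andP[rzN rU] H.
(* [r'] serves for the inner quantifiers and leaves z alone; z is renamed last, by
   [variant_here]. *)
pose r' := upd r z z.
have r'E v : v != z -> r' v = r v by rewrite /r' /upd => /negbTE ->.
have r'z : r' z = z by rewrite /r' /upd eqxx.
have zsE : [seq r' v | v <- zs] = [seq r v | v <- zs].
  by apply/eq_in_map => v vzs; apply: r'E; apply: contraNneq zzs => <-.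
have [rz_zs rz_free] := H z (mem_head _ _).
have {}IH : variant (prenex zs E As)
    (prenex [seq r v | v <- zs] (ren_eqs r' E) (ren_atoms r' As)).
  rewrite -zsE; apply: IH => //.
  - move=> v vzs; have [->//|vz] := eqVneq v z.
    by rewrite r'E // rN // inE negb_or vz.
  - by rewrite zsE.
  - move=> v vzs; have vz : v != z by apply: contraNneq zzs => <-.
    have [] := H v; first by rewrite inE vzs orbT.
    by rewrite r'E // inE negb_or => /andP[].
apply: rt_trans (variant_foldr [:: z] IH) _; apply: rt_step.
set G := prenex _ _ _.
have -> : prenex [seq r v | v <- zs] (ren_eqs r E) (ren_atoms r As) =
    rename (upd id z (r z)) G.
  rewrite rename_prenex => [|_ /mapP[v vzs ->]]; last first.
    rewrite /upd; case: eqP => // rvz.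
    case: (H v); first by rewrite inE vzs orbT.
    by rewrite rvz mem_head.
  rewrite rename_matrix ren_eqs_comp ren_atoms_comp.
  have [-> ->] // : ren_eqs r E = ren_eqs (upd id z (r z) \o r') E /\
      ren_atoms r As = ren_atoms (upd id z (r z) \o r') As.
  apply: eq_rename_matrix => v _; rewrite /= /upd /=.
  have [->|vz] := eqVneq v z; first by rewrite r'z eqxx.
  rewrite r'E //; case: eqP => // rvz.
  have [vzs|vzs] := boolP (v \in z :: zs).
    by case: (H v vzs); rewrite rvz mem_head.
  by move: rvz; rewrite rN // => vz'; rewrite vz' eqxx in vz.
apply: variant_here; last exact: substitutable_prenex.
rewrite /G free_prenex -rename_matrix => -[_ /free_rename_matrix[v vF]].
have [->|vz] := eqVneq v z.
  by rewrite r'z => rzz; rewrite rzz mem_head in rz_zs.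
rewrite r'E // => rzv; have [vzs|vzs] := boolP (v \in zs).
  by case/negP: rzN; rewrite rzv map_f.
by case: rz_free; rewrite rzv rN // inE negb_or vz.
Qed.

Lemma eval_inj X (iX : inhabited X) (h h' : valuation (tree_model L iX)) t :
  eval h t = eval h' t -> forall v, occurs v t -> h v = h' v.
Proof.
elim/term_induction: t => [x /= ? _ ->//|f a IH] /= /Node_inj/ffunP e v [i vi].
by apply: (IH i) => //; have := e i; rewrite !ffunE.
Qed.

Lemma tree_of_inj : injective (@tree_of L).
Proof.
elim/term_induction => [x|f a IH] [y|g b] //; first by case=> ->.
move=> e; have fg : f = g by case: e.
case: _ / fg b e => b /Node_inj/ffunP ab; congr App; apply/ffunP => i.
by apply: IH; have := ab i; rewrite !ffunE.
Qed.

End Solved.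

(** * Equivalent solved forms *)

Lemma swapP (uv : seq (var * var)) w :
  [\/ exists2 p, p \in uv & w = p.1 /\ swap uv w = p.2,
      exists2 p, p \in uv & w = p.2 /\ swap uv w = p.1
    | swap uv w = w /\ forall p, p \in uv -> w <> p.1 /\ w <> p.2].
Proof.
elim: uv => [|p uv IH]; first by constructor 3.
rewrite [swap _ _]/= -/(swap uv w).
have [->|wp1] := eqVneq w p.1.
  by constructor 1; exists p; rewrite ?mem_head.
have [->|wp2] := eqVneq w p.2.
  by constructor 2; exists p; rewrite ?mem_head.
case: IH => [[q quv H]|[q quv H]|[-> H]].
- by constructor 1; exists q; rewrite // inE quv orbT.
- by constructor 2; exists q; rewrite // inE quv orbT.
- constructor 3; split=> // q; rewrite inE => /orP[/eqP ->|/H //].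
  by split; apply/eqP.
Qed.

(** * Exchanges along an injection *)

Section SwapGraph.
Variables (xs : seq var) (u : var -> var).
Hypotheses (uxs : forall x, x \in xs -> u x \notin xs)
  (uI : {in xs &, injective u}).
Let uv := [seq (x, u x) | x <- xs].

Lemma swap_fst x : x \in xs -> swap uv x = u x.
Proof.
move=> xxs; case: (swapP uv x) => [[_ /mapP[y yxs ->] [/= -> ->]]||[_ H]] //.
- by case=> _ /mapP[y yxs ->] [/= xy _]; have := uxs yxs; rewrite -xy xxs.
- by case: (H (x, u x)) => //; apply: map_f.
Qed.

Lemma swap_snd x : x \in xs -> swap uv (u x) = x.
Proof.
move=> xxs; case: (swapP uv (u x)) => [[_ /mapP[y yxs ->] [/= xy _]]||[_ H]].
- by have := uxs xxs; rewrite xy yxs.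
- by case=> _ /mapP[y yxs ->] [/= /uI -> // ->].
- by case: (H (x, u x)) => //; apply: map_f.
Qed.

Lemma swap_id w : w \notin xs -> (forall x, x \in xs -> w <> u x) ->
  swap uv w = w.
Proof.
move=> wxs wu; case: (swapP uv w) => [[_ /mapP[y yxs ->] [/= e _]]||[]//].
  by rewrite e yxs in wxs.
by case=> _ /mapP[y yxs ->] [/= /(wu _ yxs)].
Qed.

(** Under the hypotheses on u, distinct pairs (x, u x) have no variable in common. *)
Lemma swap_involutive : involutive (swap uv).
Proof.
move=> w; have [wxs|wxs] := boolP (w \in xs).
  by rewrite (swap_fst wxs) swap_snd.
have [[x xxs ->]|N] := pselect (exists2 x, x \in xs & w = u x).
  by rewrite (swap_snd xxs) swap_fst.
have wid : swap uv w = w; last by rewrite !wid.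
by apply: swap_id => // x xxs e; apply: N; exists x.
Qed.

End SwapGraph.

(** * Canonical solutions in a term model *)

Section SolvedForms.
Variable L : language.
Implicit Types (Q : query L) (zs : seq var) (E : seq (var * term L))
  (As : seq (atom L)).

(* In this model a free variable v is represented by [inl v] and a bound one by
   [inr v], so that no clash between them is possible. *)
Let M : preinterp L := tree_model L (inhabits (inl 0 : var + var)).

Definition inst zs : valuation M :=
  fun v => Leaf L (if v \in zs then inr v else inl v).

(** The most general solution. A variable of [zs] that is no left-hand side also takes its [inl]
    leaf: outside the prefix it is not the quantified variable. *)
Definition canon zs E : valuation M := fun v =>
  foldr (fun e t => if v == e.1 then eval (inst zs) e.2 else t)
    (Leaf L (inl v)) E.

Lemma canon_in zs E e : uniq [seq e.1 | e <- E] -> List.In e E ->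
  canon zs E e.1 = eval (inst zs) e.2.
Proof.
rewrite /canon; elim: E => [|e' E IH] //= /andP[e'E EU] [->|eE].
  by rewrite eqxx.
case: eqP => [ee'|_]; last exact: IH.
by case/negP: e'E; rewrite -ee'; apply/In_mem/In_map; exists e.
Qed.

Lemma canon_notin zs E v : v \notin [seq e.1 | e <- E] ->
  canon zs E v = Leaf L (inl v).
Proof.
rewrite /canon; elim: E => [|e E IH] //=.
by rewrite inE negb_or => /andP[/negbTE -> /IH].
Qed.

Lemma solved_fst zs E As : solved_data zs E As ->
  [/\ uniq [seq e.1 | e <- E], uniq zs &
      forall x, x \in [seq e.1 | e <- E] -> x \notin zs].
Proof.
case=> + _ _ _; rewrite cat_uniq => /and3P[EU /hasPn H zsU]; split=> // x xE.
by apply: contraTN xE => /H.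
Qed.

Lemma mem_fst E e : List.In e E -> e.1 \in [seq e.1 | e <- E].
Proof. by move=> eE; apply/In_mem/In_map; exists e. Qed.

Lemma fst_mem E x : x \in [seq e.1 | e <- E] -> exists t, List.In (x, t) E.
Proof. by move=> /In_mem/In_map[[y t] ? ->]; exists t. Qed.

Lemma solved_occurs zs E As : solved_data zs E As -> forall v,
  (forall e, List.In e E -> occurs v e.2 -> v \notin [seq e.1 | e <- E]) /\
  (forall A, List.In A As -> occurs_atom v A -> v \notin [seq e.1 | e <- E]).
Proof.
case=> _ X _ _ v; split=> y yE vy; apply/negP => /fst_mem[t /X[X1 X2]].
  exact: X1 yE vy.
exact: X2 yE vy.
Qed.

Definition canon_atoms zs As : seq (base M) :=
  [seq papp_map (eval (inst zs)) A | A <- As].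

Lemma sat_canon zs E As : solved_data zs E As ->
  sat zs E As (canon_atoms zs As) (canon zs E).
Proof.
move=> sD; have [EU _ Ezs] := solved_fst sD; have sO := solved_occurs sD.
(* The bound variables take their [inr] leaves as witnesses. Right-hand sides and atoms contain no
   eliminated variable, so there h agrees with [inst zs]. *)
pose h v : M := if v \in zs then Leaf L (inr v) else canon zs E v.
have hE v : v \notin [seq e.1 | e <- E] -> inst zs v = h v.
  by rewrite /inst /h => /canon_notin ->; case: ifP.
exists h; split=> [v /negbTE vzs|e eE|]; first by rewrite /h vzs.
- rewrite {1}/h (negbTE (Ezs _ (mem_fst eE))) canon_in //.
  by apply: eq_eval => v ve; apply: hE; apply: (sO v).1 ve.
- apply: List.map_ext_in => A AAs; apply: papp_map_eq => i.
  by apply: eq_eval => v vi; apply: hE; apply: ((sO v).2 A) => //; exists i.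
Qed.

(* [tau] witnesses that the canonical solution of the first data solves the
   second one. *)
Definition transfer zs E As zs' E' As' (tau : valuation M) :=
  [/\ forall v, v \notin zs' -> tau v = canon zs E v,
      forall e, List.In e E' -> tau e.1 = eval tau e.2 &
      canon_atoms zs As = [seq papp_map (eval tau) A | A <- As']].

(** The canonical solution of the second query gives x the leaf [inl x], so the right-hand side of x
    in E must be a variable u, free by the solved form. The value of u is this leaf too; as u
    differs from x, it must be eliminated in E', by x itself. *)
Lemma transfer_fst zs E As zs' E' As' tau x :
  solved_data zs E As -> solved_data zs' E' As' ->
  transfer zs' E' As' zs E As tau ->
  x \in [seq e.1 | e <- E] -> x \notin [seq e.1 | e <- E'] ->
  exists u, List.In (x, Var u) E /\ List.In (u, Var x) E'.
Proof.
move=> sD sD' [tN tE _] xE xE'; have [t xt] := fst_mem xE.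
have [_ _ Ezs] := solved_fst sD; have [EU' _ _] := solved_fst sD'.
have := tE _ xt; rewrite /= tN ?Ezs // canon_notin //.
case: t xt => [u|//] xu /= ux; exists u; split=> //.
have uzs : u \notin zs.
  by apply/negP => uzs; case: sD => _ _ _ /(_ u _ uzs xu); apply.
move: ux; rewrite tN //.
have [uE'|uE'] := boolP (u \in [seq e.1 | e <- E']); last first.
  rewrite canon_notin // => -[xu']; have := (solved_occurs sD x).1 _ xu xu'.
  by rewrite xE.
have [t ut] := fst_mem uE'; rewrite (canon_in _ EU' ut) /=.
case: t ut => [v|//] uv /= [] ; rewrite /inst.
by case: ifP => // _ [xv]; rewrite xv.
Qed.

Definition same_sat zs E As zs' E' As' :=
  forall (bs : seq (base M)) h, sat zs E As bs h <-> sat zs' E' As' bs h.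

Lemma same_sat_transfer zs E As zs' E' As' :
  solved_data zs E As -> same_sat zs E As zs' E' As' ->
  exists tau, transfer zs E As zs' E' As' tau.
Proof. by move=> /sat_canon + sS => /sS [tau []]; exists tau. Qed.

(** Solutions of E are invariant under r, so renaming changes no value. If k solves the renamed
    equations, then k \o r solves E and is invariant; as r is an involution, so is k. *)
Lemma sat_rename (K : preinterp L) r zs E As (bs : seq (base K)) h :
  involutive r -> (forall z, z \in zs -> r z = z) ->
  (forall k : valuation K, (forall e, List.In e E -> k e.1 = eval k e.2) ->
     k \o r = k) ->
  sat zs (ren_eqs r E) (ren_atoms r As) bs h <-> sat zs E As bs h.
Proof.
move=> rK rz rE.
have mapE (k : valuation K) : k \o r = k ->
    [seq papp_map (eval k) A | A <- ren_atoms r As] =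
    [seq papp_map (eval k) A | A <- As].
  move=> kr; rewrite /ren_atoms -map_comp; apply: eq_map => A /=.
  by rewrite papp_map_comp; apply: papp_map_eq => i /=; rewrite eval_rename kr.
split=> -[k [kN kE bsE]].
  have kr : k \o r = k.
    have H e : List.In e E -> (k \o r) e.1 = eval (k \o r) e.2.
      move=> eE; rewrite -eval_rename.
      by apply: (kE (r e.1, rename_term r e.2)); apply/In_map; exists e.
    have := rE _ H; rewrite -compA => <-.
    by apply/funext => x /=; rewrite rK.
  exists k; split; rewrite // -?mapE // => e eE.
  have := kE (r e.1, rename_term r e.2); rewrite /= eval_rename kr.
  rewrite -[k (r e.1)]/((k \o r) e.1) kr; apply; apply/In_map; by exists e.
have kr := rE _ kE; exists k; split; rewrite // ?mapE //.
move=> _ /In_map[e eE ->] /=.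
by rewrite eval_rename kr -[k (r e.1)]/((k \o r) e.1) kr; apply: kE.
Qed.

Lemma swap_valuation (K : preinterp L) E (uv : seq (var * var))
    (k : valuation K) :
  (forall p, p \in uv -> List.In (p.1, Var p.2) E) ->
  (forall e, List.In e E -> k e.1 = eval k e.2) -> k \o swap uv = k.
Proof.
move=> uvE kE; apply/funext => w /=.
by case: (swapP uv w) =>
  [[p /uvE/kE /= e [-> ->]]|[p /uvE/kE /= e [-> ->]]|[->]].
Qed.

(** Variables eliminated in the first query only are exchanged with their partners. Solutions are
    kept, since exchanged variables are equal in each of them. *)
Lemma swap_stage zs E As zs' E' As' :
  solved_data zs E As -> solved_data zs' E' As' ->
  same_sat zs E As zs' E' As' ->
  exists E2 As2, [/\ elementary (prenex zs E As) (prenex zs E2 As2),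
    solved_data zs E2 As2, same_sat zs E2 As2 zs' E' As' &
    [seq e.1 | e <- E2] =i [seq e.1 | e <- E']].
Proof.
move=> sD sD' sS; have [EU zU Ezs] := solved_fst sD.
have [EU' _ _] := solved_fst sD'.
have [tau' T'] := same_sat_transfer sD sS.
have [tau T] : exists tau, transfer zs' E' As' zs E As tau.
  by apply: same_sat_transfer => // bs h; split=> /sS.
pose xs := [seq x <- [seq e.1 | e <- E] | x \notin [seq e.1 | e <- E']].
(* The partner u x satisfies x = u x in E and u x = x in E'; outside [xs] the value 0 is junk. *)
have /choice[u uE] x : exists u, x \in xs ->
    List.In (x, Var u) E /\ List.In (u, Var x) E'.
  have [|xxs] := boolP (x \in xs); last by exists 0.
  rewrite mem_filter => /andP[xE' xE].
  by have [u] := transfer_fst sD sD' T xE xE'; exists u.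
have uxs x : x \in xs -> u x \notin xs.
  move=> /uE[_ uxE']; rewrite mem_filter negb_and negbK.
  by rewrite (mem_fst uxE').
(* The left-hand side u x has a single equation in E', and that equation determines x. *)
have uI : {in xs &, injective u}.
  move=> x y /uE[_ ux] /uE[_ uy] uxy; rewrite -uxy in uy.
  by have [] := In_functional EU' ux uy.
pose uv := [seq (x, u x) | x <- xs]; pose r := swap uv.
have uvE p : p \in uv -> List.In (p.1, Var p.2) E.
  by move=> /mapP[x /uE[xE _] ->].
have rK : involutive r by apply: swap_involutive.
have rz z : z \in zs -> r z = z.
  move=> zzs; apply: swap_id => // [|x /uE[xE _] zu].
    apply: contraTN zzs; rewrite mem_filter => /andP[_]; exact: Ezs.
  by case: sD => _ _ _ /(_ z _ zzs xE); apply; rewrite zu.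
exists (ren_eqs r E), (ren_atoms r As); split.
- rewrite /prenex -rename_matrix -rename_prenex //; apply: elem_swap => //.
  rewrite -map_comp map_inj_in_uniq // filter_uniq //.
- by apply: solved_data_rename => //; apply: inv_inj.
- move=> bs h; rewrite -sS; apply: sat_rename => // k kE.
  exact: swap_valuation kE.
have -> : [seq e.1 | e <- ren_eqs r E] = [seq r x | x <- [seq e.1 | e <- E]].
  by rewrite -!map_comp.
(* An x eliminated in both queries is fixed: it occurs in no right-hand side of E, so it is nobody's
   partner. *)
have rE x : x \in [seq e.1 | e <- E] -> r x \in [seq e.1 | e <- E'].
  move=> xE; have [xxs|xxs] := boolP (x \in xs).
    by rewrite /r swap_fst //; have [_ /mem_fst] := uE x xxs.
  rewrite /r swap_id //; first by move: xxs; rewrite mem_filter xE andbT negbK.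
  move=> y /uE[yE _] xu; have := (solved_occurs sD x).1 _ yE.
  by rewrite /= xu -xu xE => /(_ erefl).
move=> x; apply/idP/idP => [/mapP[y /rE ? ->]//|xE'].
rewrite -[x]rK map_f //; have [xE|xE] := boolP (x \in [seq e.1 | e <- E]).
  rewrite /r swap_id //; first by rewrite mem_filter xE'.
  move=> y /uE[yE _] xu; have := (solved_occurs sD x).1 _ yE.
  by rewrite /= xu -xu xE => /(_ erefl).
(* With the roles of the queries exchanged, an x eliminated in E' only is seen to be the partner of
   some y in [xs]. *)
have [y [xy yx]] := transfer_fst sD' sD T' xE' xE.
have yxs : y \in xs.
  rewrite mem_filter (mem_fst yx) andbT.
  by apply: (solved_occurs sD' y).1 xy _.
have -> : x = u y by have [/(In_functional EU yx) []] := uE y yxs.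
by rewrite /r swap_snd // (mem_fst yx).
Qed.

(** * Matching variables along two solutions *)

Section Matching.
Variables (xs zs zs' : seq var) (tau tau' : valuation M).
Hypotheses
  (tauN : forall v, v \notin xs -> v \notin zs -> tau v = Leaf L (inl v))
  (tauN' : forall v, v \notin xs -> v \notin zs' -> tau' v = Leaf L (inl v)).

(** The first clause makes the correspondence of bound variables invertible; the second prevents a
    free variable from being captured when the bound ones are renamed. *)
Definition matched v : Prop :=
  if v \in zs then exists2 z', z' \in zs' &
    tau v = Leaf L (inr z') /\ tau' z' = Leaf L (inr v)
  else v \notin zs'.

(** The substitution [k] takes [inst zs'] to [tau'] on t'. Applied to the first equation it shows,
    with the second, that [k] takes [tau] to [inst zs] on t, hence at each variable of t; only
    leaves can be mapped to leaves. *)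
Lemma match_term t t' :
  (forall v, occurs v t -> v \notin xs) ->
  (forall v, occurs v t' -> v \notin xs) ->
  eval tau t = eval (inst zs') t' -> eval tau' t' = eval (inst zs) t ->
  forall v, occurs v t -> matched v.
Proof.
move=> tN tN' e e' v vt.
(* The two junk values [inl v.+1] and [inl 0] are never equal to [inst zs v]
   for the relevant v, so that they exclude these cases. *)
pose k (w : var + var) : M := match w with
  | inl w => Leaf L (inl (if w \in zs' then w.+1 else w))
  | inr w => if w \in zs' then tau' w else Leaf L (inl 0)
  end.
have kE : eval (teval k \o tau) t = eval (inst zs) t.
  have hk : hom (K1 := M) (K2 := M) (teval k) by [].
  have := congr1 (teval k) e; rewrite !(hom_eval _ _ hk) => ->.
  rewrite -e'; apply: eq_eval => w /tN' wxs.
  by rewrite /inst /=; case: ifP => /= [->//|wzs']; rewrite wzs' tauN' ?wzs'.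
have := @eval_inj _ _ (inhabits (inl 0)) _ _ _ kE _ vt.
rewrite /matched /inst /=.
case: ifP => [vzs|/negbT vzs].
  case: (tau v) => [[w|w]|f a] //=; case: ifP => // wzs' e2.
  by exists w.
rewrite tauN ?tN //= => -[]; case: ifP => // _ /eqP.
by rewrite eqn_leq ltnn.
Qed.

Definition collapse : tree L (var + var) -> tree L var :=
  teval (K := tree_model L (inhabits 0))
    (fun w => Leaf L (match w with inl v => v | inr v => v end)).

(** Once the tags for free and bound are forgotten, both sides are the trees of ordinary terms, and
    [tree_of] is injective. *)
Lemma match_rename (p : var -> var) t t' :
  (forall v, occurs v t ->
     tau v = Leaf L (if v \in zs then inr (p v) else inl (p v))) ->
  eval tau t = eval (inst zs') t' -> t' = rename_term p t.
Proof.
move=> tp e; apply: tree_of_inj.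
have hc : hom (K1 := M) (K2 := tree_model L (inhabits 0)) collapse by [].
have -> : tree_of t' = collapse (eval (inst zs') t').
  rewrite (hom_eval _ _ hc) /tree_of.
  apply: (@eq_eval _ (tree_model L (inhabits 0))) => v _; rewrite /inst /=.
  by case: ifP.
rewrite -e (hom_eval _ _ hc) /tree_of eval_rename.
apply: (@eq_eval _ (tree_model L (inhabits 0))) => v vt /=.
by rewrite tp //; case: ifP.
Qed.

(** A' is rewritten over the head of A, so that the arguments of both atoms have the same index
    type. *)
Lemma match_atom (A A' : atom L) :
  papp_map (eval tau) A = papp_map (eval (inst zs')) A' ->
  papp_map (eval tau') A' = papp_map (eval (inst zs)) A ->
  exists2 a', A' = PApp a' & forall i,
    eval tau (args A i) = eval (inst zs') (a' i) /\
    eval tau' (a' i) = eval (inst zs) (args A i).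
Proof.
case: A A' => [p a] [q b] /= e; have pq := congr1 (@head _ _) e.
rewrite /= in pq; case: _ / pq b e => b /PApp_inj/ffunP e /PApp_inj/ffunP e'.
by exists b => // i; have := (e i, e' i); rewrite !ffunE => -[].
Qed.

End Matching.

Lemma Forall2_In_l (S R : Type) (P : S -> R -> Prop) s t x :
  List.Forall2 P s t -> List.In x s -> exists y, P x y.
Proof. by elim=> [//|y z s' t' yz _ IH] [<-|/IH//]; exists z. Qed.

Lemma map_eq_Forall2 (S T R R' : Type) (f : S -> R) (g : T -> R) (f' : S -> R')
    (g' : T -> R') s t :
  [seq f x | x <- s] = [seq g x | x <- t] ->
  [seq f' x | x <- s] = [seq g' x | x <- t] ->
  List.Forall2
    (fun x y => [/\ List.In x s, List.In y t, f x = g y & f' x = g' y]) s t.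
Proof.
elim: s t => [|x s IH] [|y t] //= [e1 e2] [e3 e4]; constructor.
  by split=> //; left.
apply: List.Forall2_impl (IH _ e2 e4) => x' y' [? ? ? ?].
by split=> //; right.
Qed.

(** * Solved forms with the same eliminated variables *)

Section Linked.
Variables (zs zs' : seq var) (E E' : seq (var * term L))
  (As As' : seq (atom L)).
Variables (tau tau' : valuation M).
Hypotheses (sD : solved_data zs E As) (sD' : solved_data zs' E' As').
Hypotheses (EE' : [seq e.1 | e <- E] =i [seq e.1 | e <- E']).
Hypotheses (T : transfer zs' E' As' zs E As tau)
  (T' : transfer zs E As zs' E' As' tau').

Lemma transfer_free v :
  v \notin [seq e.1 | e <- E] -> v \notin zs -> tau v = Leaf L (inl v).
Proof. by case: T => tN _ _ vE vzs; rewrite tN // canon_notin // -EE'. Qed.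

(** Equations are paired by their common left-hand side, which is not bound, so that [tau] and
    [tau'] take their canonical values there. *)
Lemma linked_eqs e : List.In e E ->
  exists2 t', List.In (e.1, t') E' &
    eval tau e.2 = eval (inst zs') t' /\ eval tau' t' = eval (inst zs) e.2.
Proof.
move=> eE; have /fst_mem [t' et'] : e.1 \in [seq e.1 | e <- E'].
  by rewrite -EE' mem_fst.
have [EU _ Ezs] := solved_fst sD; have [EU' _ Ezs'] := solved_fst sD'.
case: T T' => tN tE _ [tN' tE' _]; exists t' => //; split.
  by rewrite -tE // tN ?(Ezs _ (mem_fst eE)) // (canon_in _ EU' et').
by have /= <- := tE' _ et'; rewrite tN' ?(Ezs' _ (mem_fst et')) // canon_in.
Qed.

Lemma linked_atoms : List.Forall2 (fun A A' => [/\ List.In A As, List.In A' As',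
    papp_map (eval tau) A = papp_map (eval (inst zs')) A' &
    papp_map (eval (inst zs)) A = papp_map (eval tau') A']) As As'.
Proof. by case: T T' => _ _ eA [_ _ eA']; apply: map_eq_Forall2. Qed.

End Linked.

Lemma linked_matched zs zs' E E' As As' tau tau' :
  solved_data zs E As -> solved_data zs' E' As' ->
  [seq e.1 | e <- E] =i [seq e.1 | e <- E'] ->
  transfer zs' E' As' zs E As tau -> transfer zs E As zs' E' As' tau' ->
  forall v, free v (matrix E As) -> v \notin [seq e.1 | e <- E] ->
  matched zs zs' tau tau' v.
Proof.
move=> sD sD' EE' T T' v; set xs := [seq e.1 | e <- E].
have tN := transfer_free EE' T; have tN' : forall w, w \notin xs ->
    w \notin zs' -> tau' w = Leaf L (inl w).
  move=> w; rewrite EE'; apply: (transfer_free _ T').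
  by move=> y; rewrite EE'.
case/free_matrix=> [[e eE]|[A AAs]].
  case=> [->|ve _]; first by rewrite (mem_fst eE).
  have [t' et' [e1 e2]] := linked_eqs sD sD' EE' T T' eE.
  apply: (match_term tN tN' _ _ e1 e2 ve) => w wo.
    exact: (solved_occurs sD w).1 wo.
  by rewrite EE'; apply: (solved_occurs sD' w).1 et' wo.
case=> i vi _.
have [A' [_ A'As' e1 /esym e2]] := Forall2_In_l (linked_atoms T T') AAs.
have [a' A'E /(_ i)[{}e1 {}e2]] := match_atom e1 e2.
apply: (match_term tN tN' _ _ e1 e2 vi) => w wo.
  by apply: (solved_occurs sD w).2 AAs _; exists i.
by rewrite EE'; apply: (solved_occurs sD' w).2 A'As' _; rewrite A'E; exists i.
Qed.

Lemma linked_isomorphic zs zs' E E' As As' :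
  solved_data zs E As -> solved_data zs' E' As' ->
  same_sat zs E As zs' E' As' ->
  [seq e.1 | e <- E] =i [seq e.1 | e <- E'] ->
  isomorphic (prenex zs E As) (prenex zs' E' As').
Proof.
move=> sD sD' sS EE'; have [EU zU Ezs] := solved_fst sD.
have [EU' zU' Ezs'] := solved_fst sD'.
have [tau' T'] := same_sat_transfer sD sS.
have [tau T] : exists tau, transfer zs' E' As' zs E As tau.
  by apply: same_sat_transfer => // bs h; split=> /sS.
have EE'' : [seq e.1 | e <- E'] =i [seq e.1 | e <- E] by move=> y; rewrite EE'.
have mD := linked_matched sD sD' EE' T T'.
have mD' := linked_matched sD' sD EE'' T' T.
(* A bound variable occurs in the matrix and is not eliminated, hence it is matched. *)
have zP z : z \in zs -> exists2 z', z' \in zs' &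
    tau z = Leaf L (inr z') /\ tau' z' = Leaf L (inr z).
  move=> zzs; have := mD z; rewrite /matched zzs; apply.
    by case: sD => _ _ + _; apply.
  by apply: contraTN zzs => /Ezs.
have zP' z : z \in zs' -> exists2 z', z' \in zs &
    tau' z = Leaf L (inr z') /\ tau z' = Leaf L (inr z).
  move=> zzs; have := mD' z; rewrite /matched zzs; apply.
    by case: sD' => _ _ + _; apply.
  by apply: contraTN zzs => /Ezs'.
have /choice[p0 p0E] z : exists z', z \in zs -> [/\ z' \in zs',
    tau z = Leaf L (inr z') & tau' z' = Leaf L (inr z)].
  have [/zP[z' ? []]|] := boolP (z \in zs); last by exists 0.
  by exists z'.
pose p v := if v \in zs then p0 v else v.
have pz z : z \in zs -> p z = p0 z by rewrite /p => ->.
have pN z : z \notin zs -> p z = z by rewrite /p => /negbTE ->.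
have pI : {in zs &, injective p}.
  move=> y z yzs zzs; rewrite !pz // => yz.
  have [[_ _ ey] [_ _ ez]] := (p0E y yzs, p0E z zzs).
  by move: ey; rewrite yz ez => -[].
have pzs : [seq p z | z <- zs] =i zs'.
  move=> z; apply/mapP/idP => [[y yzs ->]|/zP'[y yzs [_ ey]]].
    by rewrite pz //; case: (p0E y yzs).
  by exists y => //; rewrite pz //; case: (p0E y yzs); rewrite ey => _ [].
have ptau v : v \notin [seq e.1 | e <- E] ->
    tau v = Leaf L (if v \in zs then inr (p v) else inl (p v)).
  move=> vE; have [vzs|vzs] := ifPn; first by rewrite pz //; case: (p0E v vzs).
  by rewrite pN // (transfer_free EE' T).
have pE e : List.In e E -> List.In (p e.1, rename_term p e.2) E'.
  move=> eE; rewrite pN ?Ezs ?mem_fst //.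
  have [t' et' [e1 _]] := linked_eqs sD sD' EE' T T' eE.
  rewrite -(match_rename (zs := zs) (p := p) _ e1) // => v ve; apply: ptau.
  exact: (solved_occurs sD v).1 ve.
(* Atoms are compared position by position, so the lists agree exactly; equations will agree only up
   to order. *)
have pA : As' = ren_atoms p As.
  have : List.Forall2 (fun A A' => A' = papp_map (rename_term p) A) As As'.
    apply: List.Forall2_impl (linked_atoms T T') => A A' [AAs _ e1 /esym e2].
    have [a' -> aE] := match_atom e1 e2; congr PApp; apply/ffunP => i.
    rewrite ffunE; apply: match_rename (aE i).1 => v vi; apply: ptau.
    by apply: (solved_occurs sD v).2 AAs _; exists i.
  by elim=> // A A' s s' -> _ ->.
have [n Mn] := free_bound (matrix E As).
(* The prefixes may overlap, so the renaming p is carried out through fresh variables, taken from N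
   on: [f] shifts the bound variables by N, and [g] sends z + N to p z. *)
pose N := maxn n (\max_(z <- zs ++ zs') z).+1.
have nN v : free v (matrix E As) -> v < N.
  by move=> /Mn vn; apply: leq_trans vn (leq_maxl _ _).
have zN z : z \in zs ++ zs' -> z < N.
  by move=> zz; rewrite leq_max ltnS leq_bigmax_seq ?orbT.
pose f v := if v \in zs then v + N else v.
have fz z : z \in zs -> f z = z + N by rewrite /f => ->.
have fN z : z \notin zs -> f z = z by rewrite /f => /negbTE ->.
have fzN z : z \in zs -> N <= f z by move=> /fz ->; apply: leq_addl.
pose ws := [seq f z | z <- zs].
have wsN w : w \in ws -> N <= w by case/mapP => z /fzN + ->.
pose g w := if w \in ws then p (w - N) else w.
have gf v : v < N -> g (f v) = p v.
  move=> vN; have [vzs|vzs] := boolP (v \in zs).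
    by rewrite /g map_f // fz // addnK.
  rewrite fN // pN // /g; case: ifP => // /wsN.
  by rewrite leqNgt vN.
have V1 : variant (prenex zs E As) (prenex ws (ren_eqs f E) (ren_atoms f As)).
  apply: variant_prenex => // [|z zzs].
    by rewrite map_inj_in_uniq // => y z yzs zzs; rewrite !fz // => /addIn.
  split; last by move=> /nN; rewrite ltnNge fzN.
  apply/negP => fzs; have := fzN _ zzs; rewrite leqNgt zN //.
  by rewrite mem_cat fzs.
have gws : [seq g w | w <- ws] = [seq p z | z <- zs].
  rewrite -map_comp; apply/eq_in_map => z zzs; apply: gf.
  by apply: zN; rewrite mem_cat zzs.
have pU : uniq [seq p z | z <- zs] by rewrite map_inj_in_uniq.
have V2 : variant (prenex ws (ren_eqs f E) (ren_atoms f As))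
    (prenex [seq p z | z <- zs] (ren_eqs p E) (ren_atoms p As)).
  have [<- <-] : ren_eqs (g \o f) E = ren_eqs p E /\
      ren_atoms (g \o f) As = ren_atoms p As.
    by apply: eq_rename_matrix => v /nN /gf.
  rewrite -gws -ren_eqs_comp -ren_atoms_comp; apply: variant_prenex.
  - by move=> v /negbTE vws; rewrite /g vws.
  - by rewrite map_inj_in_uniq // => y z yzs zzs; rewrite !fz // => /addIn.
  - by rewrite gws.
  move=> w wws; have gw : g w \in zs' by rewrite -pzs -gws map_f.
  have gwN : g w < N by apply: zN; rewrite mem_cat gw orbT.
  split; first by apply/negP => /wsN; rewrite leqNgt gwN.
  rewrite -rename_matrix => /free_rename_matrix[v vF gwf].
  have [vzs|vzs] := boolP (v \in zs).
    by have := fzN _ vzs; rewrite -gwf leqNgt gwN.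
  (* A free variable of the first query that is bound in the second would contradict the second
     clause of [matched]. *)
  rewrite fN // in gwf; have := mD v vF; rewrite /matched (negbTE vzs) -gwf gw.
  by case/(_ _)/negP => //; rewrite EE'; apply: contraTN gw => /Ezs'.
apply: rt_trans (rt_step _ _ _ _ (elem_variant _ (rt_trans _ _ _ _ _ V1 V2))) _.
  by constructor 3; exists zs, E, As.
(* The remaining difference is the order of the quantifiers and of the equations. *)
have Pz : Permutation [seq p z | z <- zs] zs'.
  apply: NoDup_Permutation; try exact/uniq_NoDup.
  by move=> z; split=> /In_mem; [rewrite pzs|rewrite -pzs] => /In_mem.
have fstp : [seq e.1 | e <- ren_eqs p E] = [seq e.1 | e <- E].
  rewrite -map_comp; apply: List.map_ext_in => e eE /=.
  by rewrite pN ?Ezs ?mem_fst.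
have PE : Permutation (ren_eqs p E) E'.
  apply: NoDup_Permutation.
  - apply: (@List.NoDup_map_inv _ _ fst); apply/uniq_NoDup.
    by rewrite -fstp in EU.
  - by apply: (@List.NoDup_map_inv _ _ fst); apply/uniq_NoDup.
  (* Conversely, an equation of E' shares its left-hand side with a renamed equation of E, and
     left-hand sides are unique. *)
  move=> e; split=> [/In_map[e0 /pE ? ->]//|eE'].
  have /fst_mem[t et] : e.1 \in [seq e.1 | e <- ren_eqs p E].
    by rewrite fstp EE' mem_fst.
  have /In_map[e0 /pE e0E' e0E] := et.
  rewrite -e0E in e0E'; case: e eE' et e0E e0E' => x t' /= xt' xt _ xtE'.
  by rewrite (In_functional EU' xt' xtE').
rewrite -pA; apply: rt_step; apply: elem_perm => //.
apply: solved_data_perm sD'; exact: Permutation_sym.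
Qed.

(** The equivalence is applied in the term model [M], where the canonical solutions live. *)
Lemma solved_isomorphic Q Q' :
  solved Q -> solved Q' -> eqQ Q Q' -> isomorphic Q Q'.
Proof.
pose FM := tree_model_FEA L (inhabits (inl 0 : var + var)).
(* [QTrue] is the prenex form with empty data, so only [QFalse] needs separate treatment; it lacks
   the canonical solution that every other solved form has. *)
have True_data : solved_data [::] [::] [::] by [].
have reflect Q0 : solved Q0 -> Q0 = QFalse \/
    exists zs E As, solved_data zs E As /\ Q0 = prenex zs E As.
  by case=> [->|->|H]; [right; exists [::], [::], [::]|left|right].
have not_False zs E As : solved_data zs E As -> ~ leJ M (prenex zs E As) QFalse.
  move=> /sat_canon S []; rewrite natoms_prenex natoms_matrix => sA H.
  apply: (H (singles (canon_atoms zs As)) _ (canon zs E)).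
    by rewrite !size_map.
  by apply/satP => //; rewrite size_map.
move=> /reflect[->|[zs [E [As [sD ->]]]]]
  /reflect[->|[zs' [E' [As' [sD' ->]]]]].
- by move=> _; apply: rt_refl.
- by case=> _ /(_ _ FM) /not_False; case.
- by case=> /(_ _ FM) /not_False; case.
case=> /(_ _ FM) le /(_ _ FM) le'.
have sS : same_sat zs E As zs' E' As'.
  by move=> bs h; split; apply: leJ_sat.
have [E2 [As2 [el sD2 sS2 EE2]]] := swap_stage sD sD' sS.
apply: rt_trans (rt_step _ _ _ _ el) _.
exact: linked_isomorphic.
Qed.

End SolvedForms.

Theorem theorem4p11 (L : language) (hL : exists c : fsym L, farity c = 0)
    (Q Q' : query L) :
  (forall J : preinterp L, FEA_model J -> nontrivial J ->
     (eqJ J Q Q' <-> eqQ Q Q') /\ (leJ J Q Q' <-> leQ Q Q')) /\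
  (solved Q -> solved Q' -> eqQ Q Q' -> isomorphic Q Q').
Proof.
split=> [J FJ ntJ|]; last exact: solved_isomorphic.
have le (P P' : query L) : leJ J P P' <-> leQ P P'.
  by split=> [|/(_ J FJ)//]; apply: leJ_leQ.
by rewrite eqJ_leJ !le.
Qed.
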